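(* Let $\Omega\subset\mathbb{R}^N$ be a regular cone, $Q:\mathbb{C}^M\times\mathbb{C}^M\to\mathbb{C}^N$ an $\Omega$-positive Hermitian map, and $W\subset\mathbb{C}^M$ a real subspace. The action of $G^W$ on $\mathcal{D}(\Omega,Q)$ is strongly visible with respect to an involutive anti-holomorphic diffeomorphism if and only if $W$ contains a real form $W_0$ of $\mathbb{C}^M$ such that $$\mathrm{Im}\,Q(W_0,W_0)=0.$$
   Context: $N,M$ are positive integers. A regular cone $\Omega\subset\mathbb{R}^N$ is a nonempty open convex cone containing no entire straight line. A Hermitian map $Q:\mathbb{C}^M\times\mathbb{C}^M\to\mathbb{C}^N$ is a sesquilinear map (complex linear in the first variable, antilinear in the second) with $Q(v,u)=\overline{Q(u,v)}$; it is $\Omega$-positive if $Q(u,u)\in\overline{\Omega}\setminus\{0\}$ for all $u\neq 0$. Put $$\mathcal{D}(\Omega,Q)=\{(z,u)\in\mathbb{C}^N\times\mathbb{C}^M\mid \mathrm{Im}\,z-Q(u,u)\in\Omega\}.$$ For $x_0\in\mathbb{R}^N$, $u_0\in\mathbb{C}^M$ let $n(x_0,u_0)$ be the affine transformation $$(z,u)\mapsto(z+x_0+2iQ(u,u_0)+iQ(u_0,u_0),\,u+u_0)$$ of $\mathbb{C}^N\times\mathbb{C}^M$; it preserves $\mathcal{D}(\Omega,Q)$. For a real subspace $W\subset\mathbb{C}^M$ put $G^W=\{n(x,u)\mid x\in\mathbb{R}^N,u\in W\}$, a Lie group under composition. A real form of $\mathbb{C}^M$ is a real subspace $W_0$ with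 $\mathbb{C}^M=W_0\oplus iW_0$. Let a Lie group $H$ act on a connected complex manifold $D$ by holomorphic automorphisms. The action is previsible if there exist a totally real submanifold $S$ of $D$ and a nonempty $H$-invariant open subset $D'$ of $D$ such that $S$ meets every $H$-orbit in $D'$. A previsible action is strongly visible if (for such $S$, $D'$) there exists an anti-holomorphic diffeomorphism $\sigma$ of $D'$ such that $\sigma|_S=\mathrm{id}$ and $\sigma$ preserves each $H$-orbit of $D'$. It is strongly visible with respect to an involutive anti-holomorphic diffeomorphism if $\sigma$ can be taken with $\sigma^2=\mathrm{id}$. *)

(* Defs.v *)
From HB Require Import structures.
From mathcomp Require Import all_boot all_order all_algebra.
From mathcomp Require Import complex.
From mathcomp Require Import all_classical all_reals all_analysis.
Set Implicit Arguments.
Unset Strict Implicit.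
Unset Printing Implicit Defensive.
Import Order.TTheory GRing.Theory Num.Theory numFieldNormedType.Exports.
Local Open Scope classical_set_scope.
Local Open Scope ring_scope.
Local Open Scope complex_scope.

(* the topology of R[i] induced by its modulus *)
HB.instance Definition _ (R : realType) :=
  NormedModule.copy R[i] R[i]^o.

Notation cspace R N M := ('rV[R[i]]_N * 'rV[R[i]]_M)%type (only parsing).

Definition rowRe (R : realType) (n : nat) (z : 'rV[R[i]]_n) : 'rV[R]_n :=
  map_mx (@complex.Re R) z.

Definition rowIm (R : realType) (n : nat) (z : 'rV[R[i]]_n) : 'rV[R]_n :=
  map_mx (@complex.Im R) z.

Definition rowC (R : realType) (n : nat) (x : 'rV[R]_n) : 'rV[R[i]]_n :=
  map_mx (real_complex R) x.

Definition rowconj (R : realType) (n : nat) (z : 'rV[R[i]]_n) : 'rV[R[i]]_n :=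
  map_mx (@conjc R) z.

Definition regular_cone (R : realType) (N : nat) (Om : set 'rV[R]_N) : Prop :=
  [/\ Om !=set0, open Om, convex_set Om,
      forall (t : R) x, 0 < t -> Om x -> Om (t *: x)
    & forall x v : 'rV[R]_N, v != 0 -> ~ (forall t : R, Om (x + t *: v))].

Definition hermitian_map (R : realType) (N M : nat)
    (Q : 'rV[R[i]]_M -> 'rV[R[i]]_M -> 'rV[R[i]]_N) : Prop :=
  [/\ forall (a : R[i]) u u' v, Q (a *: u + u') v = a *: Q u v + Q u' v,
      forall (a : R[i]) u v v', Q u (a *: v + v') = a^* *: Q u v + Q u v'
    & forall u v, Q v u = rowconj (Q u v)].

Definition cone_positive (R : realType) (N M : nat) (Om : set 'rV[R]_N)
    (Q : 'rV[R[i]]_M -> 'rV[R[i]]_M -> 'rV[R[i]]_N) : Prop :=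
  forall u, u != 0 -> (@rowC R N @` (closure Om `\ 0)) (Q u u).

(* Q u u is a real vector when Q is Hermitian, so rowRe is the identification
   of a real point of C^N with the corresponding point of R^N *)
Definition siegel_domain (R : realType) (N M : nat) (Om : set 'rV[R]_N)
    (Q : 'rV[R[i]]_M -> 'rV[R[i]]_M -> 'rV[R[i]]_N) : set (cspace R N M) :=
  [set p | Om (rowIm p.1 - rowRe (Q p.2 p.2))].

Definition heis (R : realType) (N M : nat)
    (Q : 'rV[R[i]]_M -> 'rV[R[i]]_M -> 'rV[R[i]]_N)
    (x0 : 'rV[R]_N) (u0 : 'rV[R[i]]_M) (p : cspace R N M) : cspace R N M :=
  (p.1 + rowC x0 + (2 * 'i) *: Q p.2 u0 + 'i *: Q u0 u0, p.2 + u0).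

Definition heis_group (R : realType) (N M : nat)
    (Q : 'rV[R[i]]_M -> 'rV[R[i]]_M -> 'rV[R[i]]_N) (W : set 'rV[R[i]]_M) :
    set (cspace R N M -> cspace R N M) :=
  [set g | exists x u, W u /\ g = heis Q x u].

Definition real_subspace (R : realType) (M : nat) (W : set 'rV[R[i]]_M) : Prop :=
  W 0 /\ forall (a : R) u v, W u -> W v -> W (a%:C *: u + v).

Definition real_form (R : realType) (M : nat) (W0 : set 'rV[R[i]]_M) : Prop :=
  [/\ real_subspace W0,
      forall u, exists w w', [/\ W0 w, W0 w' & u = w + 'i *: w']
    & forall w w', W0 w -> W0 w' -> w = 'i *: w' -> w = 0].

(* For U finite-dimensional and A open, this is C^k regularity of f on A in the
   usual sense: f is C^k.+1 iff it is differentiable with all its directional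
   derivatives of class C^k. *)
Fixpoint class_C (R : realType) (U V : normedModType R) (k : nat)
    (A : set U) (f : U -> V) : Prop :=
  match k with
  | 0%N => forall x, A x -> {for x, continuous f}
  | k'.+1 => (forall x, A x -> differentiable f x) /\
             forall v, class_C k' A (fun x => 'd f x v)
  end.

Definition smooth_on (R : realType) (U V : normedModType R)
    (A : set U) (f : U -> V) : Prop :=
  forall k, class_C k A f.

Notation rspace R N M :=
  (('rV[R]_N * 'rV[R]_N) * ('rV[R]_M * 'rV[R]_M))%type (only parsing).

(* cspace R N M is a normed module over R[i] only; its real differential
   structure is that of rspace R N M, through these coordinates *)
Definition rcoord (R : realType) (N M : nat) (p : cspace R N M) : rspace R N M :=
  ((rowRe p.1, rowIm p.1), (rowRe p.2, rowIm p.2)).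

(* multiplication by 'i in the coordinates rcoord *)
Definition cstruct (R : realType) (N M : nat) (q : rspace R N M) : rspace R N M :=
  ((- q.1.2, q.1.1), (- q.2.2, q.2.1)).

(* f restricted to the open set V of R^k is an immersion and a homeomorphism
   onto the relatively open subset S `&` B of S *)
Definition local_param (R : realType) (N M k : nat) (S B : set (cspace R N M))
    (V : set 'rV[R]_k) (f : 'rV[R]_k -> cspace R N M) : Prop :=
  [/\ open B, open V,
      smooth_on V (@rcoord R N M \o f),
      forall t, V t -> forall v, 'd (@rcoord R N M \o f) t v = 0 -> v = 0
    & f @` V = S `&` B /\
      exists g : cspace R N M -> 'rV[R]_k,
        {within S `&` B, continuous g} /\ forall t, V t -> g (f t) = t].

(* the range of the differential of f at t is the tangent space T of S at f t;
   totally real means that T meets 'i T trivially *)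
Definition totally_real_at (R : realType) (N M k : nat)
    (f : 'rV[R]_k -> cspace R N M) (t : 'rV[R]_k) : Prop :=
  let df := 'd (@rcoord R N M \o f) t in
  forall v w, df v = cstruct (df w) -> df v = 0.

Definition totally_real_submanifold (R : realType) (N M : nat)
    (D S : set (cspace R N M)) : Prop :=
  S `<=` D /\
  exists k : nat, forall p, S p ->
    exists (B : set (cspace R N M)) (V : set 'rV[R]_k)
           (f : 'rV[R]_k -> cspace R N M),
      [/\ B p, local_param S B V f & forall t, V t -> totally_real_at f t].

Definition cspaceconj (R : realType) (N M : nat) (p : cspace R N M) :
    cspace R N M :=
  (rowconj p.1, rowconj p.2).

(* differentiability over R[i] is complex differentiability, and D' is open
   wherever this is used *)
Definition antiholomorphic_on (R : realType) (N M : nat)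
    (D' : set (cspace R N M)) (s : cspace R N M -> cspace R N M) : Prop :=
  forall p, D' p -> differentiable (@cspaceconj R N M \o s) p.

Definition antiholomorphic_diffeo (R : realType) (N M : nat)
    (D' : set (cspace R N M)) (s : cspace R N M -> cspace R N M) : Prop :=
  exists s' : cspace R N M -> cspace R N M,
    [/\ (forall p, D' p -> D' (s p)) /\ (forall p, D' p -> D' (s' p)),
        forall p, D' p -> s' (s p) = p,
        forall p, D' p -> s (s' p) = p,
        antiholomorphic_on D' s
      & antiholomorphic_on D' s'].

(* In what follows H is a group of holomorphic automorphisms of the domain D,
   given as a set of transformations of the ambient space preserving D. *)
Definition act_orbit (T : Type) (H : set (T -> T)) (p : T) : set T :=
  [set h p | h in H].

Definition previsible_with (R : realType) (N M : nat) (D : set (cspace R N M))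
    (H : set (cspace R N M -> cspace R N M)) (S D' : set (cspace R N M)) : Prop :=
  [/\ totally_real_submanifold D S,
      D' `<=` D,
      open D' /\ D' !=set0,
      forall h p, H h -> D' p -> D' (h p)
    & forall p, D' p -> S `&` act_orbit H p !=set0].

Definition strongly_visible_with (R : realType) (N M : nat)
    (D : set (cspace R N M)) (H : set (cspace R N M -> cspace R N M))
    (S D' : set (cspace R N M)) (s : cspace R N M -> cspace R N M) : Prop :=
  [/\ previsible_with D H S D',
      antiholomorphic_diffeo D' s,
      forall p, D' p -> S p -> s p = p
    & forall p, D' p -> s @` act_orbit H p = act_orbit H p].

Definition strongly_visible_involutive (R : realType) (N M : nat)
    (D : set (cspace R N M)) (H : set (cspace R N M -> cspace R N M)) : Prop :=
  exists S D' s, strongly_visible_with D H S D' s /\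
                 forall p, D' p -> s (s p) = p.

(* Main.v *)
(* Let [s] be the anti-holomorphic involution and [b] its complex conjugate. The
   orbits are the fibres of (z, u) |-> (Im z - Q(u, u), u mod W), so [s] has a
   fixed point p where S meets D', preserves Im z - Q(u, u), and moves u by
   elements of W. Restricted to a complex line through p, the preserved quantity
   shows that the quadratic form |x|^2 (Q(h, h) - Q(T h, T h)) is, to second
   order, the real part of a holomorphic function, where T is the u-component of
   the differential of [s] at p. Since a holomorphic real part has no strict
   local minimum, T preserves Q; hence, by positivity, T does not depend on the
   z-direction, and it is an antilinear involution of C^M with T u - u in W. Its
   (-1)-eigenspace is the required real form.

   Only complex differentiability is known for [b], so the absence of strict
   minima is obtained from Goursat's bisection argument in the coordinates
   log z, which gives the mean value property.

   Conversely, if c is the conjugation with respect to W0, the involution is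
   (z, u) |-> (- conj z, - c u), and the slice is (i R^N + i W0) in the domain. *)
Require Import Defs.
From HB Require Import structures.
From mathcomp Require Import all_boot all_order all_algebra.
From mathcomp Require Import complex.
From mathcomp Require Import all_classical all_reals all_analysis.
From mathcomp Require Import ring lra.
Set Implicit Arguments.
Unset Strict Implicit.
Unset Printing Implicit Defensive.
Import Order.TTheory GRing.Theory Num.Theory numFieldNormedType.Exports.
Local Open Scope classical_set_scope.
Local Open Scope ring_scope.
Local Open Scope complex_scope.

(** * Integrals of continuous functions over segments *)

Section SegmentIntegral.
Context {R : realType}.
Implicit Types (f g : R -> R) (a b c m : R).

Definition segint f a b : R := \int[@lebesgue_measure R]_(t in `[a, b]) f t.

Definition cont_seg f a b := forall t, a <= t <= b -> {for t, continuous f}.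

Lemma cont_segB f g a b :
  cont_seg f a b -> cont_seg g a b -> cont_seg (fun t => f t - g t) a b.
Proof. by move=> cf cg t tab; apply: cvgB; [exact: cf|exact: cg]. Qed.

Lemma cont_seg_integrable f a b : cont_seg f a b ->
  (@lebesgue_measure R).-integrable `[a, b] (EFin \o f).
Proof.
move=> cf; apply: continuous_compact_integrable; first exact: segment_compact.
apply: continuous_in_subspaceT => t; rewrite inE /= in_itv /= => tab.
exact: cf.
Qed.

Lemma segint_chasles f a b c : a <= c <= b -> cont_seg f a b ->
  segint f a b = segint f a c + segint f c b.
Proof.
move=> /andP[ac cb] cf.
have := @Rintegral_itvB R f (BLeft a) (BRight b) c (cont_seg_integrable cf).
rewrite !bnd_simp => /(_ ac cb) E.
rewrite {3}/segint -Rintegral_itv_obnd_cbnd; last first.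
  apply: integrableS (cont_seg_integrable cf) => //.
  by apply: subset_itvr; rewrite bnd_simp.
by rewrite -E /segint addrC subrK.
Qed.

Lemma segintB f g a b : cont_seg f a b -> cont_seg g a b ->
  segint (fun t => f t - g t) a b = segint f a b - segint g a b.
Proof.
move=> cf cg; rewrite /segint RintegralB//; exact: cont_seg_integrable.
Qed.

Lemma segint_cst m a b : a <= b -> segint (fun=> m) a b = m * (b - a).
Proof.
move=> ab; rewrite /segint Rintegral_cst//= (@lebesgue_measure_itv R `[a, b]) /=.
rewrite lte_fin; case: ltP => //= ba.
by rewrite (_ : b = a) ?subrr ?mulr0//; apply/eqP; rewrite eq_le ab ba.
Qed.

Lemma le_segint f g a b : cont_seg f a b -> cont_seg g a b ->
  (forall t, a <= t <= b -> f t <= g t) -> segint f a b <= segint g a b.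
Proof.
by move=> cf cg fg; apply: le_Rintegral => //; exact: cont_seg_integrable.
Qed.

Lemma cont_seg_cst m a b : cont_seg (fun=> m) a b.
Proof. by move=> t _; apply: cvg_cst. Qed.

Lemma segint_dist f a b m e : a <= b -> cont_seg f a b ->
  (forall t, a <= t <= b -> `|f t - m| <= e) ->
  `|segint f a b - m * (b - a)| <= e * (b - a).
Proof.
move=> ab cf H.
have h1 : segint f a b <= (m + e) * (b - a).
  rewrite -segint_cst//; apply: le_segint => //; first exact: cont_seg_cst.
  by move=> t /H; rewrite ler_norml => /andP[_]; rewrite lerBlDl.
have h2 : (m - e) * (b - a) <= segint f a b.
  rewrite -segint_cst//; apply: le_segint => //; first exact: cont_seg_cst.
  by move=> t /H; rewrite ler_norml => /andP[+ _]; rewrite lerBrDl.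
by rewrite ler_norml; apply/andP; split; nra.
Qed.

End SegmentIntegral.

(** * Goursat's theorem for closed forms on rectangles *)

Section Goursat.
Context {R : realType}.
Implicit Types (f P Q : R -> R -> R).

(** Total differentiability at one point, with gradient [(A, B)]. Nothing is said about how the
    gradient varies with the point. *)
Definition has_diff2 f (x y A B : R) := forall e : R, 0 < e ->
  exists2 d : R, 0 < d & forall x' y', `|x' - x| <= d -> `|y' - y| <= d ->
    `|f x' y' - f x y - (A * (x' - x) + B * (y' - y))| <=
      e * (`|x' - x| + `|y' - y|).

Lemma has_diff2_lip f x y A B : has_diff2 f x y A B ->
  exists2 d : R, 0 < d & forall x' y', `|x' - x| <= d -> `|y' - y| <= d ->
    `|f x' y' - f x y| <= (1 + `|A| + `|B|) * (`|x' - x| + `|y' - y|).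
Proof.
move=> /(_ 1 ltr01) [d d0 H]; exists d => // x' y' hx hy.
have := H _ _ hx hy; rewrite mul1r => {}H.
have -> : f x' y' - f x y = (f x' y' - f x y - (A * (x' - x) + B * (y' - y)))
   + A * (x' - x) + B * (y' - y) by ring.
rewrite (le_trans (ler_normD _ _))// (le_trans (lerD (ler_normD _ _) (lexx _)))//.
rewrite !normrM.
have := normr_ge0 A; have := normr_ge0 B.
have := normr_ge0 (x' - x); have := normr_ge0 (y' - y); move: H.
move: `|x' - x| `|y' - y| `|A| `|B| => a b A' B' H *; nra.
Qed.

Lemma has_diff2_cont1 f x y A B : has_diff2 f x y A B ->
  {for x, continuous (f^~ y)}.
Proof.
move=> /has_diff2_lip[d d0 H]; apply/cvgrPdistC_le => /= e e0.
have K0 : 0 < 1 + `|A| + `|B| by rewrite ltr_pwDl// ltr_pwDl.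
have near_x (r : R) : 0 < r -> \forall t \near x, `|t - x| <= r.
  by move=> r0; exact: (@cvgr_distC_le _ _ _ _ _ id x cvg_id r r0).
near=> t.
have /= := H t y; rewrite subrr normr0 addr0 => H'.
apply: le_trans (H' _ (ltW d0)) _; first by near: t; exact: near_x.
rewrite mulrC -ler_pdivlMr//; near: t.
by apply: near_x; exact: divr_gt0.
Unshelve. all: by end_near. Qed.

Lemma has_diff2_swap f x y A B :
  has_diff2 f x y A B -> has_diff2 (fun a b => f b a) y x B A.
Proof.
move=> H e /H[d d0 {}H]; exists d => // x' y' hx hy.
by rewrite addrC [B * _ + _]addrC [`|x' - y| + _]addrC addrC; exact: H.
Qed.

Lemma has_diff2_cont2 f x y A B : has_diff2 f x y A B ->
  {for y, continuous (f x)}.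
Proof. by move=> /has_diff2_swap/has_diff2_cont1. Qed.

(* the integral of [P dx + Q dy] along the boundary of the rectangle with lower
   left corner [(x, y)] and side lengths [w], [h] *)
Definition circulation P Q x y w h :=
  segint (fun t => P t y - P t (y + h)) x (x + w) +
  segint (fun t => Q (x + w) t - Q x t) y (y + h).

(** The shared coefficient [B] is the closedness condition: the [y]-derivative of [P] equals the
    [x]-derivative of [Q]. *)
Definition closed_form_at P Q x y := exists A B C,
  has_diff2 P x y A B /\ has_diff2 Q x y B C.

Definition closed_form_on P Q x y w h := forall a b,
  x <= a <= x + w -> y <= b <= y + h -> closed_form_at P Q a b.

(** The common side of the two rectangles is traversed once in each direction, so its contributions
    cancel. *)
Lemma circulation_splitx P Q x y w1 w2 h : 0 <= w1 -> 0 <= w2 -> 0 <= h ->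
  closed_form_on P Q x y (w1 + w2) h ->
  circulation P Q x y (w1 + w2) h =
  circulation P Q x y w1 h + circulation P Q (x + w1) y w2 h.
Proof.
move=> w10 w20 h0 cl.
have cP b : y <= b <= y + h -> cont_seg (P^~ b) x (x + (w1 + w2)).
  by move=> yb t xt; have [A [B [C [/has_diff2_cont1 ? _]]]] := cl _ _ xt yb.
have cQ a : x <= a <= x + (w1 + w2) -> cont_seg (Q a) y (y + h).
  by move=> xa t yt; have [A [B [C [_ /has_diff2_cont2 ?]]]] := cl _ _ xa yt.
have cQ1 := cQ x ltac:(lra); have cQ2 := cQ (x + w1) ltac:(lra).
have cQ3 := cQ (x + (w1 + w2)) ltac:(lra).
have cP1 := cP y ltac:(lra); have cP2 := cP (y + h) ltac:(lra).
rewrite /circulation (@segint_chasles _ _ x (x + (w1 + w2)) (x + w1))//; last 2 first.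
- by lra.
- exact: cont_segB.
rewrite -[x + w1 + w2]addrA (segintB cQ3 cQ1) (segintB cQ2 cQ1) (segintB cQ3 cQ2).
by ring.
Qed.

Lemma circulation_splity P Q x y w h1 h2 : 0 <= w -> 0 <= h1 -> 0 <= h2 ->
  closed_form_on P Q x y w (h1 + h2) ->
  circulation P Q x y w (h1 + h2) =
  circulation P Q x y w h1 + circulation P Q x (y + h1) w h2.
Proof.
move=> w0 h10 h20 cl.
have cP b : y <= b <= y + (h1 + h2) -> cont_seg (P^~ b) x (x + w).
  by move=> yb t xt; have [A [B [C [/has_diff2_cont1 ? _]]]] := cl _ _ xt yb.
have cQ a : x <= a <= x + w -> cont_seg (Q a) y (y + (h1 + h2)).
  by move=> xa t yt; have [A [B [C [_ /has_diff2_cont2 ?]]]] := cl _ _ xa yt.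
have cQ1 := cQ x ltac:(lra); have cQ2 := cQ (x + w) ltac:(lra).
have cP1 := cP y ltac:(lra); have cP2 := cP (y + h1) ltac:(lra).
have cP3 := cP (y + (h1 + h2)) ltac:(lra).
rewrite /circulation (@segint_chasles _ _ y (y + (h1 + h2)) (y + h1))//; last 2 first.
- by lra.
- exact: cont_segB.
rewrite -[y + h1 + h2]addrA (segintB cP1 cP3) (segintB cP1 cP2) (segintB cP2 cP3).
by ring.
Qed.

Lemma closed_form_onS P Q x y w h x' y' w' h' :
  x <= x' -> y <= y' -> x' + w' <= x + w -> y' + h' <= y + h ->
  closed_form_on P Q x y w h -> closed_form_on P Q x' y' w' h'.
Proof. by move=> hx hy hw hh cl a b ha hb; apply: cl; lra. Qed.

(** Pigeonhole: the circulation is the sum of those of the four quarters, so they cannot all be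
    smaller than [c] in absolute value. *)
Lemma circulation_quarter P Q x y w h (c : R) : 0 <= w -> 0 <= h ->
  closed_form_on P Q x y (w + w) (h + h) ->
  4 * c <= `|circulation P Q x y (w + w) (h + h)| ->
  exists x' y', [/\ x <= x' <= x + w, y <= y' <= y + h &
    c <= `|circulation P Q x' y' w h|].
Proof.
move=> w0 h0 cl; apply: contraPP => /forallNP H.
have K x' y' : x <= x' <= x + w -> y <= y' <= y + h ->
    `|circulation P Q x' y' w h| < c.
  by move=> hx hy; rewrite ltNge; apply/negP => hc; apply: (H x'); exists y'.
apply/negP; rewrite -ltNge circulation_splitx//; last lra.
rewrite !circulation_splity//; try lra.
- have k1 := K x y ltac:(lra) ltac:(lra); have k2 := K (x + w) y ltac:(lra) ltac:(lra).
  have k3 := K x (y + h) ltac:(lra) ltac:(lra).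
  have k4 := K (x + w) (y + h) ltac:(lra) ltac:(lra).
  apply: le_lt_trans (ler_normD _ _) _.
  apply: le_lt_trans (lerD (ler_normD _ _) (ler_normD _ _)) _.
  by lra.
- by apply: closed_form_onS cl; lra.
- by apply: closed_form_onS cl; lra.
Qed.

(** The affine parts of [P] and [Q] at [(p, q)] contribute [- B * h * w] and [B * w * h], which
    cancel by closedness. Only the errors of the linear approximations remain. *)
Lemma circulation_small P Q p q A B C (e : R) : 0 < e ->
  has_diff2 P p q A B -> has_diff2 Q p q B C ->
  exists2 d : R, 0 < d & forall x y w h, 0 <= w <= d -> 0 <= h <= d ->
    x <= p <= x + w -> y <= q <= y + h -> closed_form_on P Q x y w h ->
    `|circulation P Q x y w h| <= e * (w + h) ^+ 2.
Proof.
(* Each integrand is a difference of two values, and each value gets half of [e]. *)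
move=> e0 dP dQ; have e20 : 0 < e / 2 by lra.
have [d1 d10 H1] := dP _ e20; have [d2 d20 H2] := dQ _ e20.
exists (Num.min d1 d2); first by rewrite lt_min d10 d20.
move=> x y w h; rewrite !le_min.
move=> /andP[w0 /andP[wd1 wd2]] /andP[h0 /andP[hd1 hd2]] hp hq cl.
have cP b : y <= b <= y + h -> cont_seg (P^~ b) x (x + w).
  by move=> yb t xt; have [A' [B' [C' [/has_diff2_cont1 ? _]]]] := cl _ _ xt yb.
have cQ a : x <= a <= x + w -> cont_seg (Q a) y (y + h).
  by move=> xa t yt; have [A' [B' [C' [_ /has_diff2_cont2 ?]]]] := cl _ _ xa yt.
have cQ1 := cQ x ltac:(lra); have cQ2 := cQ (x + w) ltac:(lra).
have cP1 := cP y ltac:(lra); have cP2 := cP (y + h) ltac:(lra).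
have nx t : x <= t <= x + w -> `|t - p| <= w by rewrite ler_norml; lra.
have ny t : y <= t <= y + h -> `|t - q| <= h by rewrite ler_norml; lra.
have K1 a b : x <= a <= x + w -> y <= b <= y + h ->
    `|P a b - P p q - (A * (a - p) + B * (b - q))| <= e / 2 * (w + h).
  move=> /nx ha /ny hb; apply: le_trans (H1 _ _ _ _) _; try lra.
  by rewrite ler_wpM2l// ?lerD//; lra.
have K2 a b : x <= a <= x + w -> y <= b <= y + h ->
    `|Q a b - Q p q - (B * (a - p) + C * (b - q))| <= e / 2 * (w + h).
  move=> /nx ha /ny hb; apply: le_trans (H2 _ _ _ _) _; try lra.
  by rewrite ler_wpM2l// ?lerD//; lra.
have S1 := @segint_dist _ (fun t => P t y - P t (y + h)) x (x + w) (- B * h)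
   (e * (w + h))
   ltac:(lra) (cont_segB cP1 cP2).
have S2 := @segint_dist _ (fun t => Q (x + w) t - Q x t) y (y + h) (B * w) (e * (w + h))
   ltac:(lra) (cont_segB cQ2 cQ1).
have {}S1 : `|segint (fun t => P t y - P t (y + h)) x (x + w)
    - - B * h * (x + w - x)| <= e * (w + h) * (x + w - x).
  apply: S1 => t ht; have := K1 t y ht ltac:(lra); have := K1 t (y + h) ht ltac:(lra).
  by rewrite !ler_norml; lra.
have {}S2 : `|segint (fun t => Q (x + w) t - Q x t) y (y + h) - B * w * (y + h - y)| <=
    e * (w + h) * (y + h - y).
  apply: S2 => t ht; have := K2 x t ltac:(lra) ht; have := K2 (x + w) t ltac:(lra) ht.
  by rewrite !ler_norml; lra.
move: S1 S2; rewrite /circulation !ler_norml; lra.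
Qed.

Lemma nested_intervals (u w : nat -> R) : (forall n, 0 <= w n) ->
  (forall n, u n <= u n.+1 /\ u n.+1 + w n.+1 <= u n + w n) ->
  exists p, forall n, u n <= p <= u n + w n.
Proof.
move=> w0 H.
have K n k : u n <= u (n + k)%N /\ u (n + k)%N + w (n + k)%N <= u n + w n.
  elim: k => [|k [IH1 IH2]]; first by rewrite addn0.
  by have [] := H (n + k)%N; rewrite addnS; lra.
have ub n : ubound (range u) (u n + w n).
  move=> _ [m _ <-]; have [nm|/ltnW mn] := leqP n m.
    by have := K n (m - n)%N; rewrite subnKC//; have := w0 m; lra.
  by have := K m (n - m)%N; rewrite subnKC//; have := w0 n; lra.
exists (sup (range u)) => n; apply/andP; split.
- apply: sup_upper_bound; last by exists n.
  by split; [exists (u 0%N); exists 0%N | exists (u 0%N + w 0%N)].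
- by apply: ge_sup => //; exists (u 0%N); exists 0%N.
Qed.

(** Bisection: a nonzero circulation [c] leaves at least [c / 4 ^+ n] on some rectangle of stage
    [n]. These rectangles shrink to a point, where differentiability bounds the circulation by any
    small multiple of the squared size, which also decays like [4 ^+ n]. *)
Theorem goursat P Q x y w h : 0 <= w -> 0 <= h ->
  closed_form_on P Q x y w h -> circulation P Q x y w h = 0.
Proof.
move=> w0 h0 cl; apply/eqP; rewrite -normr_eq0; apply/eqP.
apply: contrapT => /eqP cneq0.
have c0 : 0 < `|circulation P Q x y w h| by rewrite lt0r cneq0 normr_ge0.
set c := `|_| in c0.
pose W n : R := w / 2 ^+ n; pose H n : R := h / 2 ^+ n; pose E n : R := c / 4 ^+ n.
have half (a : R) n : a / 2 ^+ n = a / 2 ^+ n.+1 + a / 2 ^+ n.+1.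
  by rewrite exprS invfM; field; rewrite expf_neq0.
have W0 n : 0 <= W n by rewrite divr_ge0// exprn_ge0.
have H0 n : 0 <= H n by rewrite divr_ge0// exprn_ge0.
(* A state records the stage and the lower left corner of the current rectangle. *)
pose inv (s : nat * (R * R)) := [/\ x <= s.2.1, s.2.1 + W s.1 <= x + w,
  y <= s.2.2, s.2.2 + H s.1 <= y + h &
  E s.1 <= `|circulation P Q s.2.1 s.2.2 (W s.1) (H s.1)|].
have step (s : {s | inv s}) : {s' : {s | inv s} |
    [/\ (sval s').1 = (sval s).1.+1,
        (sval s).2.1 <= (sval s').2.1 <= (sval s).2.1 + W (sval s).1.+1 &
        (sval s).2.2 <= (sval s').2.2 <= (sval s).2.2 + H (sval s).1.+1]}.
  apply: cid; case: s => -[n [a b]] [/= h1 h2 h3 h4 h5].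
  have eW := half w n; have eH := half h n.
  have cl' : closed_form_on P Q a b (W n.+1 + W n.+1) (H n.+1 + H n.+1).
    by apply: closed_form_onS cl; rewrite -?eW -?eH.
  have := @circulation_quarter P Q a b _ _ (E n.+1) (W0 n.+1) (H0 n.+1) cl'.
  rewrite -eW -eH (_ : 4 * E n.+1 = E n); last first.
    by rewrite /E exprS invfM; field; rewrite expf_neq0.
  move=> /(_ h5)[a' [b' [ha hb hc]]].
  have iv : inv (n.+1, (a', b')).
    by split => //=; move: ha hb h2 h4; rewrite /W /H eW eH; lra.
  by exists (exist _ _ iv).
have i0 : inv (0%N, (x, y)).
  by split => //=; rewrite /W /H /E !expr0 !divr1.
have [F [F0 FS]] := dependent_choice step (exist _ _ i0).
have F1 n : (sval (F n)).1 = n.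
  by elim: n => [|n IH]; [rewrite F0|have [-> _ _] := FS n; rewrite IH].
have [p Hp] : exists p, forall n, (sval (F n)).2.1 <= p <= (sval (F n)).2.1 + W n.
  apply: nested_intervals => // n; have [_ + _] := FS n; rewrite F1.
  by have := half w n; rewrite -/(W n) -/(W n.+1); lra.
have [q Hq] : exists q, forall n, (sval (F n)).2.2 <= q <= (sval (F n)).2.2 + H n.
  apply: nested_intervals => // n; have [_ _] := FS n; rewrite F1.
  by have := half h n; rewrite -/(H n) -/(H n.+1); lra.
have [A [B [C [dP dQ]]]] : closed_form_at P Q p q.
  by apply: cl; [have := Hp 0%N|have := Hq 0%N]; rewrite F0 /= /W /H !expr0 !divr1.
have K0 : 0 < (w + h) ^+ 2 + 1 by rewrite ltr_wpDl// sqr_ge0.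
(* Chosen so that [e * (w + h) ^+ 2 < c], which contradicts the lower bound once both sides are
   multiplied by [4 ^+ n]. The [+ 1] covers a degenerate rectangle. *)
pose e := c / ((w + h) ^+ 2 + 1) / 2.
have e0 : 0 < e by rewrite !divr_gt0.
have [d d0 small] := circulation_small e0 dP dQ.
have shrink (a : R) : 0 <= a -> \forall n \near \oo, a / 2 ^+ n <= d.
  move=> a0; near=> n.
  have n2 : (n%:R : R) <= 2 ^+ n by rewrite -natrX ler_nat ltnW// ltn_expl.
  rewrite ler_pdivrMr ?exprn_gt0// mulrC -ler_pdivrMr//.
  by apply: le_trans n2; near: n; exact: nbhs_infty_ger.
have [n [Wd Hd]] : exists n, W n <= d /\ H n <= d.
  have [n _ Hn] : \forall n \near \oo, W n <= d /\ H n <= d.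
    by near=> n; split; near: n; exact: shrink.
  by exists n; apply: Hn => /=.
have [/= h1 h2 h3 h4 h5] := svalP (F n).
rewrite F1 in h2 h4 h5.
have := small (sval (F n)).2.1 (sval (F n)).2.2 (W n) (H n).
rewrite W0 H0 Wd Hd Hp Hq => /(_ isT isT isT isT) /(_ (closed_form_onS h1 h3 h2 h4 cl)).
move=> /(le_trans h5).
rewrite /E (_ : e * _ = e * (w + h) ^+ 2 / 4 ^+ n); last first.
  rewrite (_ : 4 = 2 * 2 :> R)%R; last by ring.
  rewrite exprMn /W /H; field; by rewrite expf_neq0.
rewrite ler_pM2r ?invr_gt0 ?exprn_gt0// /e -mulrA mulrAC.
rewrite ler_pdivlMr//.
have := c0; have := sqr_ge0 (w + h); nra.
Unshelve. all: by end_near. Qed.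

End Goursat.

(** * Chain rule and mean values over circles *)

Section MeanValue.
Context {R : realType}.
Implicit Types (u v f : R -> R -> R).

Lemma has_diff2_comp (g f1 f2 : R -> R -> R) (x y A B a1 b1 a2 b2 : R) :
  has_diff2 g (f1 x y) (f2 x y) A B ->
  has_diff2 f1 x y a1 b1 -> has_diff2 f2 x y a2 b2 ->
  has_diff2 (fun x y => g (f1 x y) (f2 x y)) x y
    (A * a1 + B * a2) (A * b1 + B * b2).
Proof.
move=> dg d1 d2 e e0.
have [n1 n10 L1] := has_diff2_lip d1; have [n2 n20 L2] := has_diff2_lip d2.
set K1 := 1 + `|a1| + _ in L1; set K2 := 1 + `|a2| + _ in L2.
have K10 : 0 < K1 by rewrite /K1 ltr_pwDl// ltr_pwDl.
have K20 : 0 < K2 by rewrite /K2 ltr_pwDl// ltr_pwDl.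
have K0 : 0 < 2 * (K1 + K2) by lra.
have [d d0 H] := dg _ (divr_gt0 e0 K0).
have M0 : 0 < 2 * (1 + `|A| + `|B|) by rewrite mulr_gt0// ltr_pwDl// ltr_pwDl.
have [m1 m10 E1] := d1 _ (divr_gt0 e0 M0); have [m2 m20 E2] := d2 _ (divr_gt0 e0 M0).
have k1 : 0 < d / (2 * K1) by rewrite divr_gt0// mulr_gt0.
have k2 : 0 < d / (2 * K2) by rewrite divr_gt0// mulr_gt0.
exists (Num.min (Num.min n1 n2) (Num.min (Num.min m1 m2)
   (Num.min (d / (2 * K1)) (d / (2 * K2))))).
  by rewrite !lt_min n10 n20 m10 m20 k1 k2.
move=> x' y'; rewrite !le_min => /andP[/andP[x1 x2] /andP[/andP[x3 x4] /andP[x5 x6]]].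
move=> /andP[/andP[y1 y2] /andP[/andP[y3 y4] /andP[y5 y6]]].
have {}L1 := L1 _ _ x1 y1; have {}L2 := L2 _ _ x2 y2.
have {}E1 := E1 _ _ x3 y3; have {}E2 := E2 _ _ x4 y4.
rewrite ler_pdivlMr ?mulr_gt0// in x5; rewrite ler_pdivlMr ?mulr_gt0// in x6.
rewrite ler_pdivlMr ?mulr_gt0// in y5; rewrite ler_pdivlMr ?mulr_gt0// in y6.
have {}H := H (f1 x' y') (f2 x' y').
have {H} : `|g (f1 x' y') (f2 x' y') - g (f1 x y) (f2 x y) -
    (A * (f1 x' y' - f1 x y) + B * (f2 x' y' - f2 x y))| <=
    e / (2 * (K1 + K2)) * (`|f1 x' y' - f1 x y| + `|f2 x' y' - f2 x y|).
  by apply: H; [apply: le_trans L1 _|apply: le_trans L2 _]; rewrite mulrDr; nra.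
set D1 := f1 x' y' - f1 x y in L1 E1 *; set D2 := f2 x' y' - f2 x y in L2 E2 *.
set G := _ - g (f1 x y) _.
set r := `|x' - x| + `|y' - y| in L1 L2 E1 E2 *.
have r0 : 0 <= r by rewrite addr_ge0.
(* Half of the allowed error goes to the approximation of [g], the other half to those of [f1] and
   [f2]. *)
have h1 : e / (2 * (K1 + K2)) * (`|D1| + `|D2|) <= e / 2 * r.
  have -> : e / 2 * r = e / (2 * (K1 + K2)) * ((K1 + K2) * r).
    by field; apply/eqP; lra.
  apply: ler_wpM2l; first by rewrite divr_ge0// ltW.
  by lra.
move=> /le_trans/(_ h1) {h1} H.
set p1 := D1 - _ in E1; set p2 := D2 - _ in E2.
have -> : G - ((A * a1 + B * a2) * (x' - x) + (A * b1 + B * b2) * (y' - y)) =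
   (G - (A * D1 + B * D2)) + A * p1 + B * p2 by rewrite /p1 /p2; ring.
have h2 : `|A * p1| + `|B * p2| <= e / 2 * r.
  have -> : e / 2 * r = (1 + `|A| + `|B|) * (e / (2 * (1 + `|A| + `|B|)) * r).
    by field; apply/eqP; lra.
  set q := e / _ * r in E1 E2 *; rewrite !normrM.
  have q0 : 0 <= q by exact: le_trans E1.
  have h3 := ler_wpM2l (normr_ge0 A) E1; have h4 := ler_wpM2l (normr_ge0 B) E2.
  by rewrite !mulrDl mul1r; lra.
apply: le_trans (ler_normD _ _) _.
by apply: le_trans (lerD (ler_normD _ _) (lexx _)) _; lra.
Qed.

Lemma is_derive_approx (p : R -> R) (x dp : R) : is_derive x 1 p dp ->
  forall e : R, 0 < e -> exists2 d : R, 0 < d & forall x', `|x' - x| <= d ->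
    `|p x' - p x - dp * (x' - x)| <= e * `|x' - x|.
Proof.
move=> [/cvg_ex[l hl] <-] e e0.
have -> : 'D_1 p x = l by exact: cvg_lim.
move/cvgrPdist_le : hl => /(_ e e0).
rewrite near_withinE => /nbhs_ballP[d /= d0 H].
exists (d / 2); first by rewrite divr_gt0.
move=> x' hx; have [->|xx] := eqVneq x' x.
  by rewrite !subrr mulr0 subrr normr0 mulr0.
have nz : x' - x != 0 by rewrite subr_eq0.
have := H (x' - x); rewrite /ball /= sub0r normrN => /(_ _ nz).
have -> : (x' - x) *: 1 + x = x' by rewrite /GRing.scale /= mulr1 subrK.
have lt : `|x' - x| < d by rewrite (le_lt_trans hx)// ltr_pdivrMr//; lra.
move=> /(_ lt) {}H.
have -> : p x' - p x - l * (x' - x) = - ((l - (x' - x)^-1 *: (p x' - p x)) * (x' - x)).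
  by rewrite /GRing.scale /=; field.
by rewrite normrN normrM ler_wpM2r.
Qed.

(** Provides the differentials of [expR s * cos t] and [expR s * sin t]. It is the chain rule for
    multiplication, whose remainder is the product of the two increments. *)
Lemma has_diff2_mul (p q : R -> R) (x y dp dq : R) :
  is_derive x 1 p dp -> is_derive y 1 q dq ->
  has_diff2 (fun a b => p a * q b) x y (dp * q y) (p x * dq).
Proof.
have D1 (g : R -> R) (a b dg : R) : is_derive a 1 g dg ->
    has_diff2 (fun s _ => g s) a b dg 0.
  move=> /is_derive_approx H e /[dup] e0 /H[d d0 {}H]; exists d => // a' b' ha _.
  by rewrite mul0r addr0 (le_trans (H _ ha))// ler_pM2l// lerDl.
move=> /(D1 p x y) d1 /(D1 q y x)/has_diff2_swap d2.
suff dg : has_diff2 (fun a b => a * b) (p x) (q y) (q y) (p x).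
  have := has_diff2_comp dg d1 d2.
  by rewrite !mulr0 addr0 add0r [q y * _]mulrC.
move=> e e0; exists e => // a b ha hb.
have -> : a * b - p x * q y - (q y * (a - p x) + p x * (b - q y)) =
   (a - p x) * (b - q y) by ring.
rewrite normrM mulrDr (le_trans (ler_wpM2r _ ha))//.
by rewrite lerDr mulr_ge0// ltW.
Qed.

(* The form [u dtheta + v ds] is closed in the coordinates [(s, theta)] with
   [z = exp (s + i theta)]; its circulation along [s0, s1] x [0, 2 pi] vanishes,
   so the mean of [u] over circles is independent of the radius. *)
Lemma harmonic_no_strict_min (u v : R -> R -> R) (r : R) : 0 < r ->
  (forall a b, a ^+ 2 + b ^+ 2 < r -> exists A B,
     has_diff2 u a b A (- B) /\ has_diff2 v a b B A) ->
  u 0 0 = 0 ->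
  ~ (forall a b, 0 < a ^+ 2 + b ^+ 2 < r -> 0 < u a b).
Proof.
move=> r0 CR u0 upos.
pose X (s t : R) : R := expR s * cos t; pose Y (s t : R) : R := expR s * sin t.
have XY s t : X s t ^+ 2 + Y s t ^+ 2 = expR s ^+ 2.
  by rewrite /X /Y !exprMn -mulrDr cos2Dsin2 mulr1.
pose P s t := v (X s t) (Y s t); pose Q s t := u (X s t) (Y s t).
(* The Cauchy-Riemann equations make the [t]-derivative of [P] and the [s]-derivative of [Q] both
   equal to [A * X s t - B * Y s t]. *)
have cl s t : expR s ^+ 2 < r -> closed_form_at P Q s t.
  move=> sr; have [|A [B [du dv]]] := CR (X s t) (Y s t); first by rewrite XY.
  have dX : has_diff2 X s t (X s t) (- Y s t).
    by rewrite /Y -mulrN; apply: has_diff2_mul.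
  have dY : has_diff2 Y s t (Y s t) (X s t) by apply: has_diff2_mul.
  have dP := has_diff2_comp dv dX dY; have dQ := has_diff2_comp du dX dY.
  exists (B * X s t + A * Y s t), (B * - Y s t + A * X s t),
    (A * - Y s t + - B * X s t).
  split => //; move: dQ; congr has_diff2; ring.
(* Radius of the outer circle. Since [r] bounds the squared radius, the minimum with [1] is what
   gives [q ^+ 2 < r]. *)
pose q := Num.min r 1 / 2.
have q0 : 0 < q by rewrite divr_gt0// lt_min r0 ltr01.
have qr : q ^+ 2 < r.
  rewrite /q; have : Num.min r 1 <= r by rewrite ge_min lexx.
  have : Num.min r 1 <= 1 by rewrite ge_min lexx orbT.
  by move: q0; rewrite /q; set m := Num.min r 1; nra.
pose s1 := ln q.
have es1 : expR s1 = q by rewrite lnK.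
have pi0 := pi_gt0 R.
have cQ s : expR s ^+ 2 < r -> forall t, {for t, continuous (Q s)}.
  by move=> sr t; have [A [B [C [_ /has_diff2_cont2]]]] := cl s t sr.
(* By compactness [u] has a minimum [m] on the outer circle, which is positive. *)
have [c _ Hc] : exists2 c, c \in `[0, 2 * pi] &
    forall t, t \in `[0, 2 * pi] -> Q s1 c <= Q s1 t.
  apply: EVT_min; first by lra.
  by apply: continuous_subspaceT => t; apply: cQ; rewrite es1.
set m := Q s1 c in Hc.
have m0 : 0 < m by apply: upos; rewrite XY es1 qr exprn_gt0.
have [A [B [/has_diff2_lip[d d0 L] _]]] := CR 0 0 ltac:(by rewrite expr0n addr0).
set K := 1 + _ + _ in L.
have K0 : 0 < K by rewrite /K ltr_pwDl// ltr_pwDl.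
(* Radius of the inner circle: as [u] vanishes at the origin and is Lipschitz there with constant
   [K], it is at most [K * (2 * q')], hence at most [m / 2], on this circle. *)
pose q' := Num.min q (Num.min d (m / (4 * K))).
have q'0 : 0 < q' by rewrite !lt_min q0 d0 divr_gt0// mulr_gt0.
have q'q : q' <= q by rewrite ge_min lexx.
pose s0 := ln q'.
have es0 : expR s0 = q' by rewrite lnK.
have s01 : s0 <= s1 by rewrite ler_ln.
have small t : Q s0 t <= m / 2.
  have b1 : `|X s0 t| <= q'.
    rewrite normrM es0 gtr0_norm//; apply: ler_piMr; [exact: ltW|].
    by rewrite ler_norml cos_geN1 cos_le1.
  have b2 : `|Y s0 t| <= q'.
    rewrite normrM es0 gtr0_norm//; apply: ler_piMr; [exact: ltW|].
    by rewrite ler_norml sin_geN1 sin_le1.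
  have q'd : q' <= d by rewrite !ge_min lexx orbT.
  have q'm : q' <= m / (4 * K) by rewrite !ge_min lexx !orbT.
  rewrite ler_pdivlMr ?mulr_gt0// in q'm.
  have := L (X s0 t) (Y s0 t); rewrite u0 !subr0.
  move=> /(_ (le_trans b1 q'd) (le_trans b2 q'd)).
  rewrite ler_norml => /andP[_]; rewrite -/(Q s0 t) => h.
  by apply: le_trans h _; nra.
have clR : closed_form_on P Q s0 0 (s1 - s0) (2 * pi).
  move=> s t /andP[_ ss] _; apply: cl; apply: le_lt_trans qr.
  rewrite ler_sqr ?nnegrE ?expR_ge0 ?(ltW q0)// -es1 ler_expR.
  by move: ss; rewrite addrC subrK.
have w0 : 0 <= s1 - s0 by rewrite subr_ge0.
have h0 : 0 <= 2 * pi :> R by rewrite mulr_ge0// ltW.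
have := goursat w0 h0 clR.
rewrite /circulation !(addrC s0) subrK add0r.
(* The sides at angles [0] and [2 * pi] have the same image in the plane. *)
have -> : segint (fun t => P t 0 - P t (2 * pi)) s0 s1 = 0.
  have -> : (fun t => P t 0 - P t (2 * pi)) = (fun=> 0).
    apply/funext => t; rewrite /P /X /Y.
    by rewrite (_ : 2 * pi = pi *+ 2) ?cos2pi ?sin2pi ?cos0 ?sin0 ?subrr// mulr_natl.
  by rewrite segint_cst// mul0r.
rewrite add0r => int0.
(* The outer values exceed the inner ones by at least [m / 2], although their integrals agree. *)
have : segint (fun=> m / 2) 0 (2 * pi) <= segint (fun t => Q s1 t - Q s0 t) 0 (2 * pi).
  apply: le_segint; first exact: cont_seg_cst.
    apply: cont_segB => t _; apply: cQ; rewrite ?es1// es0.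
    by apply: le_lt_trans qr; rewrite ler_sqr// nnegrE ltW.
  move=> t ht; have := Hc t; rewrite in_itv /= => /(_ ht).
  by have := small t; lra.
rewrite int0 segint_cst; last by lra.
by rewrite subr0; have := mulr_gt0 m0 pi0; lra.
Qed.

End MeanValue.

(** * Continuity and differentiability of linear maps *)

Section NormedLemmas.

Lemma cvg_finsum (K : numFieldType) (V : normedModType K) (T : Type)
    (F : set_system T) {FF : Filter F} n (f : 'I_n -> T -> V) (l : 'I_n -> V) :
  (forall j, f j x @[x --> F] --> l j) ->
  (\sum_j f j x) @[x --> F] --> \sum_j l j.
Proof.
elim: n f l => [|n IH] f l H.
  rewrite big_ord0 (_ : (fun _ => _) = fun=> 0); first exact: cvg_cst.
  by apply/funext => x; rewrite big_ord0.
rewrite big_ord_recl (_ : (fun _ => _) = fun x =>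
    f ord0 x + \sum_(j < n) f (lift ord0 j) x); last first.
  by apply/funext => x; rewrite big_ord_recl.
by apply: cvgD; [exact: H|exact: IH].
Qed.

Lemma rV_continuous (K : numFieldType) (T : topologicalType) n
    (f : T -> 'rV[K]_n) (x : T) :
  (forall j, {for x, continuous (fun y => f y 0 j)}) -> {for x, continuous f}.
Proof.
move=> cf; rewrite (_ : f = fun y => \sum_j f y 0 j *: delta_mx 0 j); last first.
  by apply/funext => y; rewrite {1}[f y]row_sum_delta.
apply: (@cvg_finsum _ _ _ (nbhs x)) => j; apply: cvgZr_tmp; exact: cf.
Qed.

Lemma rV_linear_continuous (K : numFieldType) (W : normedModType K) n
    (f : 'rV[K]_n -> W) : linear f -> continuous f.
Proof.
move=> lf.
pose L : {linear 'rV[K]_n -> W} := HB.pack f (GRing.isLinear.Build _ _ _ _ f lf).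
rewrite (_ : f = fun y => \sum_j y 0 j *: L (delta_mx 0 j)); last first.
  apply/funext => y; rewrite -[f y]/(L y) {1}[y]row_sum_delta linear_sum.
  by apply: eq_bigr => j _; rewrite linearZ.
move=> x; apply: (@cvg_finsum _ _ _ (nbhs x)) => j; apply: cvgZr_tmp.
exact: coord_continuous.
Qed.

Lemma pair_linear_continuous (K : numFieldType) (W : normedModType K) m n
    (f : 'rV[K]_m * 'rV[K]_n -> W) : linear f -> continuous f.
Proof.
move=> lf.
rewrite (_ : f = fun p => f (p.1, 0) + f (0, p.2)); last first.
  apply/funext => -[z u] /=; have := lf 1 (z, 0) (0, u).
  by rewrite !scale1r /= => <-; congr f; congr pair; rewrite ?addr0 ?add0r.
have l1 : linear (fun z => f (z, 0)).
  move=> a z z'; rewrite -lf; congr f; congr pair => /=.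
  by rewrite scaler0 addr0.
have l2 : linear (fun u => f (0, u)).
  move=> a z z'; rewrite -lf; congr f; congr pair => /=.
  by rewrite scaler0 addr0.
move=> p; apply: cvgD.
  apply: (@cvg_comp _ _ _ fst (fun z => f (z, 0)) _ (nbhs p.1)).
    exact: cvg_fst.
  exact: (rV_linear_continuous l1).
apply: (@cvg_comp _ _ _ snd (fun z => f (0, z)) _ (nbhs p.2)).
  exact: cvg_snd.
exact: (rV_linear_continuous l2).
Qed.

Lemma linear_is_diff (K : numFieldType) (V W : normedModType K) (f : V -> W) x :
  linear f -> continuous f -> is_diff x f f.
Proof.
move=> lf cf.
pose L : {linear V -> W} := HB.pack f (GRing.isLinear.Build _ _ _ _ f lf).
apply: DiffDef; first exact: (@linear_differentiable _ _ _ L).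
exact: (@diff_lin _ _ _ L).
Qed.

Lemma diff_approx (K : numFieldType) (V W : normedModType K) (f : V -> W) x :
  differentiable f x -> forall e, 0 < e ->
  \forall h \near 0, `|f (h + x) - f x - 'd f x h| <= e * `|h|.
Proof.
move=> /diff_locally /eqaddoP H e e0; have := H e e0.
by apply: filterS => h /=; rewrite /cst !fctE opprD addrA.
Qed.

Lemma approx_is_diff (K : numFieldType) (V W : normedModType K) (f df : V -> W) x :
  linear df -> continuous df ->
  (forall e, 0 < e -> \forall h \near 0, `|f (h + x) - f x - df h| <= e * `|h|) ->
  is_diff x f df.
Proof.
move=> lf cf H.
pose L : {linear V -> W} := HB.pack df (GRing.isLinear.Build _ _ _ _ df lf).
have E : f \o shift x = cst (f x) + L +o_ 0 id.
  apply/eqaddoP => e e0; have := H e e0.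
  by apply: filterS => h /=; rewrite /cst !fctE opprD addrA.
have D : 'd f x = L :> (V -> W) by exact: diff_unique.
by apply: DiffDef; [apply/diff_locallyP; rewrite D|exact: D].
Qed.

Lemma derive_comp_is_diff (K : numFieldType) (U V W : normedModType K)
    (f : U -> V) (g dg : V -> W) x h :
  differentiable f x -> is_diff (f x) g dg ->
  'D_h (g \o f) x = dg ('D_h f x).
Proof.
move=> df [dgx dgE]; rewrite !deriveE//; last exact: differentiable_comp.
by rewrite diff_comp//= dgE.
Qed.

End NormedLemmas.

(** * Topology of the complex numbers and real parts of holomorphic functions *)

Section ComplexTopology.
Context {R : realType}.
Local Notation C := R[i].
Local Notation normc := (@ComplexField.Normc.normc R).

Lemma normC_lt (z : C) (r : R) : (`|z| < r%:C) = (normc z < r).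
Proof. by rewrite [`|z|]/Num.norm /= ltcR. Qed.

Lemma normC_le (z : C) (r : R) : (`|z| <= r%:C) = (normc z <= r).
Proof. by rewrite [`|z|]/Num.norm /= lecR. Qed.

(** A positive element of [R[i]] has zero imaginary part, so real radii suffice. *)
Lemma nbhsC (z : C) (P : set C) :
  (\forall w \near z, P w) <->
  exists2 r : R, 0 < r & forall w, normc (z - w) < r -> P w.
Proof.
split=> [/nbhs_ballP[e /= e0 H]|[r r0 H]].
  exists (complex.Re e); first by move: e0; rewrite ltcE => /andP[].
  move=> w hw; apply: H; rewrite /ball /=.
  move: e0; rewrite ltcE /= => /andP[/eqP e0 _].
  by rewrite (_ : e = (complex.Re e)%:C) ?normC_lt//; case: (e) e0 => a b /= ->.
apply/nbhs_ballP; exists r%:C; first by rewrite /= ltcR.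
by move=> w; rewrite /ball /= normC_lt; exact: H.
Qed.

Lemma normc_Re (z : C) : `|complex.Re z| <= normc z.
Proof. by rewrite -lecR; exact: normc_ge_Re. Qed.

Lemma normc_Im (z : C) : `|complex.Im z| <= normc z.
Proof.
have := normc_Re ('i * z); rewrite ComplexField.Normc.normcM.
rewrite (_ : normc 'i = 1) ?mul1r; last by rewrite /= expr0n expr1n add0r sqrtr1.
by case: z => a b /=; rewrite mul0r mul1r sub0r normrN.
Qed.

Lemma normc_le_sum (z : C) : normc z <= `|complex.Re z| + `|complex.Im z|.
Proof.
case: z => a b /=.
rewrite -[leRHS]ger0_norm ?addr_ge0// -sqrtr_sqr ler_wsqrtr//.
rewrite sqrrD !real_normK ?num_real// -addrA lerD2l lerDr.
by rewrite mulrn_wge0// mulr_ge0.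
Qed.

Lemma Re_continuous : continuous (@complex.Re R).
Proof.
move=> z; apply/(@cvgrPdist_lt _ _ _ (nbhs z)) => e e0; apply/nbhsC; exists e => // w h.
by rewrite -raddfB (le_lt_trans (normc_Re _)).
Qed.

Lemma Im_continuous : continuous (@complex.Im R).
Proof.
move=> z; apply/(@cvgrPdist_lt _ _ _ (nbhs z)) => e e0; apply/nbhsC; exists e => // w h.
by rewrite -raddfB (le_lt_trans (normc_Im _)).
Qed.

Lemma conjc_continuous : continuous (@conjc R).
Proof.
move=> z P /nbhsC[r r0 H]; apply/nbhsC; exists r => // w h; apply: H.
by rewrite -rmorphB -normC_lt normcJ normC_lt.
Qed.

Lemma real_complex_continuous : continuous (@real_complex R).
Proof.
move=> x P /nbhsC[r r0 H]; apply/nbhs_ballP; exists r => // y h; apply: H.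
by rewrite -rmorphB -normC_lt [X in X < _](_ : _ = `|x - y|%:C) ?ltcR//
  normc_def /= expr0n addr0 sqrtr_sqr.
Qed.

(** The differential is multiplication by a complex number [d]; [A] and [B] are its real and
    imaginary parts. *)
Lemma cauchy_riemann (f : C -> C) (a b : R) : differentiable f (a +i* b) ->
  exists A B,
    has_diff2 (fun x y => complex.Re (f (x +i* y))) a b A (- B) /\
    has_diff2 (fun x y => complex.Im (f (x +i* y))) a b B A.
Proof.
move=> df; set d := 'd f (a +i* b) 1.
have H (e : R) : 0 < e -> exists2 r : R, 0 < r & forall x y,
    `|x - a| <= r -> `|y - b| <= r ->
    normc (f (x +i* y) - f (a +i* b) - ((x - a) +i* (y - b)) * d) <=
      e * (`|x - a| + `|y - b|).
  move=> e0; have e0' : 0 < e%:C by rewrite ltcR.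
  have /nbhsC[r r0 H] := diff_approx df e0'.
  (* The modulus of the increment is at most the sum of two coordinates, hence at most [r / 2]. *)
  exists (r / 4); first by rewrite divr_gt0.
  move=> x y hx hy; set h := (x - a) +i* (y - b).
  have hn : normc h <= `|x - a| + `|y - b| by apply: normc_le_sum.
  have := H h; rewrite sub0r normcN.
  have hr : normc h < r by apply: le_lt_trans hn _; lra.
  move=> /(_ hr).
  have -> : h + (a +i* b) = x +i* y by rewrite /h /=; congr Complex; rewrite subrK.
  have -> : 'd f (a +i* b) h = h * d.
    by rewrite -[h in LHS]mulr1 -[h * 1]/(h *: (1 : C)) linearZ.
  rewrite [e%:C * _](_ : _ = (e * normc h)%:C); last by rewrite rmorphM.
  by rewrite normC_le => /le_trans; apply; rewrite ler_pM2l.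
exists (complex.Re d), (complex.Im d); split=> e e0; have [r r0 {}H] := H e e0;
  exists r => // x y hx hy; apply: le_trans (H x y hx hy).
- apply: le_trans (normc_Re _); rewrite !raddfB /=.
  by case: (d) => d1 d2 /=; rewrite mulNr mulrC [d2 * _]mulrC.
- apply: le_trans (normc_Im _); rewrite !raddfB /=.
  by case: (d) => d1 d2 /=; rewrite addrC mulrC [d1 * _]mulrC addrC.
Qed.

Lemma holo_no_strict_min (f : C -> C) :
  (\forall z \near 0, differentiable f z) -> complex.Re (f 0) = 0 ->
  ~ (\forall z \near 0^', 0 < complex.Re (f z)).
Proof.
move=> /nbhsC[r1 r10 df] f0; rewrite near_withinE => /nbhsC[r2 r20 fpos].
pose r := Num.min r1 r2; have r0 : 0 < r by rewrite lt_min r10 r20.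
have small a b : a ^+ 2 + b ^+ 2 < r ^+ 2 -> normc (0 - (a +i* b)) < r.
  rewrite sub0r normcN /= => h.
  by rewrite -(gtr0_norm r0) -sqrtr_sqr ltr_sqrt// exprn_gt0.
apply: (@harmonic_no_strict_min R (fun x y => complex.Re (f (x +i* y)))
   (fun x y => complex.Im (f (x +i* y))) (r ^+ 2)) => //.
- by rewrite exprn_gt0.
- move=> a b /small; rewrite lt_min => /andP[h _].
  by apply: cauchy_riemann; exact: df.
- move=> a b /andP[ab /small]; rewrite lt_min => /andP[_ h].
  apply: fpos => //; apply: contraTneq ab => -[-> ->].
  by rewrite expr0n addr0 ltxx.
Qed.

(** If [k] were positive, the real part of [f] would be positive on a punctured neighbourhood and
    zero at its centre, a strict local minimum. A negative [k] is excluded by applying this to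
    [- f]. *)
Lemma holo_quadratic (f : C -> C) (k : R) :
  (\forall z \near 0, differentiable f z) -> complex.Re (f 0) = 0 ->
  complex.Re (f z) / normc z ^+ 2 @[z --> 0^'] --> k -> k = 0.
Proof.
have pos (g : C -> C) (m : R) :
    (\forall z \near 0, differentiable g z) -> complex.Re (g 0) = 0 ->
    complex.Re (g z) / normc z ^+ 2 @[z --> 0^'] --> m -> m <= 0.
  move=> dg g0 cg; rewrite leNgt; apply/negP => m0.
  apply: (holo_no_strict_min dg g0).
  have : \forall z \near 0^', z != 0 :> C by exact: nbhs_dnbhs_neq.
  have : \forall z \near 0^', 0 < complex.Re (g z) / normc z ^+ 2.
    by apply: cvgr_gt cg _ m0.
  apply: filterS2 => z h z0; move: h; rewrite pmulr_lgt0// invr_gt0 exprn_gt0//.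
  rewrite lt0r; apply/andP; split.
    by apply: contraNneq z0 => /ComplexField.Normc.eq0_normc ->.
  by rewrite -lecR; exact: (@normr_ge0 _ _ z).
move=> df f0 cf; apply/eqP; rewrite eq_le (pos f)//=.
rewrite -oppr_le0; apply: (pos (fun z => - f z)).
- by apply: filterS df => z; exact: differentiableN.
- by rewrite raddfN /= f0 oppr0.
- rewrite (_ : (fun _ => _) = fun z => - (complex.Re (f z) / normc z ^+ 2)).
    exact: cvgN.
  by apply/funext => z; rewrite raddfN mulNr.
Qed.

End ComplexTopology.

(** * Bases of subspaces given as sets *)

Section LinearAlgebra.

(** Take a free family in [V] of maximal size; a vector of [V] outside its span could be added to
    it. *)
Lemma subspace_basis (K : fieldType) n (V : set 'rV[K]_n) :
  V 0 -> (forall (a : K) u v, V u -> V v -> V (a *: u + v)) ->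
  exists k (A : 'M[K]_(k, n)), row_free A /\ forall x, V x <-> (x <= A)%MS.
Proof.
move=> V0 VD.
pose P k := `[< exists A : 'M[K]_(k, n),
  row_free A /\ forall x : 'rV_n, (x <= A)%MS -> V x >].
have exP : exists k, P k.
  exists 0%N; apply/asboolP; exists 0; split; first by rewrite /row_free mxrank0.
  by move=> x /submxP[D ->]; rewrite mulmx0.
have ubP k : P k -> (k <= n)%N.
  by move=> /asboolP[A [fA _]]; rewrite -(eqP fA) rank_leq_col.
case: (ex_maxnP exP ubP) => k /asboolP[A [fA sA]] maxk.
exists k, A; split => // x; split; last exact: sA.
move=> Vx; apply: contrapT => /negP xA.
have : P (1 + k)%N.
  apply/asboolP; exists (col_mx x A); split; last first.
    move=> y /submxP[D ->]; rewrite -[D]hsubmxK mul_row_col.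
    rewrite [lsubmx D]mx11_scalar mul_scalar_mx; apply: VD => //.
    exact/sA/submxMl.
  (* If the pseudo-inverse is not a right inverse, the difference has a nonzero row in the left
     kernel of [col_mx x A]. Its coefficient [a] at [x] cannot vanish, as [A] is free, and otherwise
     [x] lies in the span of [A]. *)
  apply/row_freeP; exists (pinvmx (col_mx x A)).
  apply/eqP; rewrite -subr_eq0; apply: contraT => /rowV0Pn[v].
  move=> /submxP[D vD] v0; exfalso.
  have vk : v *m col_mx x A = 0.
    by rewrite vD -mulmxA mulmxBl mul1mx mulmxKpV// subrr mulmx0.
  move: vk v0; rewrite -[v]hsubmxK mul_row_col.
  set a := lsubmx v; set b := rsubmx v.
  rewrite [a]mx11_scalar mul_scalar_mx => vk.
  have [a0|a0] := eqVneq (a 0 0) 0.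
    rewrite a0 scale0r add0r in vk.
    have -> : b = 0 by apply: (row_free_inj fA); rewrite vk mul0mx.
    by rewrite a0 raddf0 row_mx0 eqxx.
  move: xA; rewrite (_ : x = (- (a 0 0)^-1 *: b) *m A) ?submxMl//.
  move/eqP: vk; rewrite addr_eq0 => /eqP vk.
  by rewrite -scalemxAl scaleNr -scalerN -vk scalerA mulVf// scale1r.
by move/maxk; rewrite add1n ltnn.
Qed.

End LinearAlgebra.

(** * Complex rows in real coordinates *)

Section ComplexRows.
Context {R : realType} {n : nat}.
Implicit Types (u v : 'rV[R[i]]_n) (a : R).

(** Through these coordinates real subspaces of complex space become row spaces of real matrices. *)
Definition realify u : 'rV[R]_(n + n) := row_mx (rowRe u) (rowIm u).

Definition complexify (x : 'rV[R]_(n + n)) : 'rV[R[i]]_n :=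
  \row_j (x 0 (lshift n j) +i* x 0 (rshift n j)).

Lemma realifyK : cancel realify complexify.
Proof.
move=> u; apply/rowP => j; rewrite mxE row_mxEl row_mxEr !mxE.
by case: (u 0 j).
Qed.

Lemma complexifyK : cancel complexify realify.
Proof.
move=> x; apply/rowP => j; rewrite mxE.
by case: split_ordP => k ->; rewrite !mxE.
Qed.

Lemma realify_linear a u v : realify (a%:C *: u + v) = a *: realify u + realify v.
Proof.
apply/rowP => j; rewrite !mxE.
case: split_ordP => k _; rewrite !mxE.
  by rewrite raddfD /=; case: (u 0 k) => b c /=; rewrite mul0r subr0.
by rewrite raddfD /=; case: (u 0 k) => b c /=; rewrite mul0r addr0.
Qed.

Lemma complexify_linear a (x y : 'rV[R]_(n + n)) :
  complexify (a *: x + y) = a%:C *: complexify x + complexify y.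
Proof. by apply: (can_inj realifyK); rewrite realify_linear !complexifyK. Qed.

Lemma realify_continuous : continuous realify.
Proof.
move=> u; apply: rV_continuous => j; case: (split_ordP j) => k ->.
  rewrite (_ : (fun _ => _) = complex.Re (R:=R) \o (fun w : 'rV[R[i]]_n => w 0 k)).
    apply: continuous_comp; [exact: coord_continuous|exact: Re_continuous].
  by apply/funext => w; rewrite /realify row_mxEl mxE.
rewrite (_ : (fun _ => _) = complex.Im (R:=R) \o (fun w : 'rV[R[i]]_n => w 0 k)).
  apply: continuous_comp; [exact: coord_continuous|exact: Im_continuous].
by apply/funext => w; rewrite /realify row_mxEr mxE.
Qed.

Lemma real_subspace_basis (W : set 'rV[R[i]]_n) : real_subspace W ->
  exists k (A : 'M[R]_(k, n + n)),
    row_free A /\ forall u, W u <-> (realify u <= A)%MS.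
Proof.
move=> [W0 WD].
have [||k [A [fA HA]]] := @subspace_basis _ _ (W \o complexify).
- rewrite /= (_ : complexify 0 = 0)//; apply/rowP => j; rewrite !mxE //.
- by move=> a u v /= Wu Wv; rewrite complexify_linear; exact: WD.
exists k, A; split=> // u; rewrite -HA /= realifyK //.
Qed.

(** [W] is the kernel of a continuous map into the cokernel of a basis matrix. Closedness lets
    limits of difference quotients stay in [W]. *)
Lemma real_subspace_closed (W : set 'rV[R[i]]_n) : real_subspace W -> closed W.
Proof.
move=> /real_subspace_basis[k [A [_ HA]]].
rewrite (_ : W = (fun u => realify u *m cokermx A) @^-1` [set 0]); last first.
  by apply/seteqP; split => u /=; rewrite HA submxE => /eqP.
apply: preimage_closed; last first.
  exact/accessible_closed_set1/hausdorff_accessible/norm_hausdorff.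
move=> u _.
apply: (@continuous_comp _ _ _ realify (fun x => x *m cokermx A)).
  exact: realify_continuous.
apply: rV_linear_continuous => a x y.
by rewrite mulmxDl scalemxAl.
Qed.

Lemma rowconjK : involutive (@rowconj R n).
Proof. by move=> u; apply/rowP => j; rewrite !mxE conjcK. Qed.

Lemma rowconjD u v : rowconj (u + v) = rowconj u + rowconj v.
Proof. by apply/rowP => j; rewrite !mxE rmorphD. Qed.

Lemma rowconjN u : rowconj (- u) = - rowconj u.
Proof. by apply/rowP => j; rewrite !mxE rmorphN. Qed.

Lemma rowconjZ (c : R[i]) u : rowconj (c *: u) = conjc c *: rowconj u.
Proof. by apply/rowP => j; rewrite !mxE rmorphM. Qed.

Lemma rowconj_continuous : continuous (@rowconj R n).
Proof.
move=> u; apply: rV_continuous => j.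
rewrite (_ : (fun _ => _) = @conjc R \o (fun w : 'rV[R[i]]_n => w 0 j)).
  apply: continuous_comp; [exact: coord_continuous|exact: conjc_continuous].
by apply/funext => w; rewrite mxE.
Qed.

Lemma rowReD (z w : 'rV[R[i]]_n) : rowRe (z + w) = rowRe z + rowRe w.
Proof. by apply/rowP => j; rewrite !mxE raddfD. Qed.

Lemma rowImD (z w : 'rV[R[i]]_n) : rowIm (z + w) = rowIm z + rowIm w.
Proof. by apply/rowP => j; rewrite !mxE raddfD. Qed.

Lemma rowRe_conj (z : 'rV[R[i]]_n) : rowRe (rowconj z) = rowRe z.
Proof. by apply/rowP => j; rewrite !mxE; case: (z 0 j). Qed.

Lemma rowIm_conj (z : 'rV[R[i]]_n) : rowIm (rowconj z) = - rowIm z.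
Proof. by apply/rowP => j; rewrite !mxE; case: (z 0 j). Qed.

Lemma rowIm_iZ (z : 'rV[R[i]]_n) : rowIm ('i *: z) = rowRe z.
Proof.
by apply/rowP => j; rewrite !mxE; case: (z 0 j) => a b /=; rewrite mul0r mul1r add0r.
Qed.

Lemma rowRe_iZ (z : 'rV[R[i]]_n) : rowRe ('i *: z) = - rowIm z.
Proof.
by apply/rowP => j; rewrite !mxE; case: (z 0 j) => a b /=; rewrite mul0r mul1r sub0r.
Qed.

Lemma rowIm_rowC (x : 'rV[R]_n) : rowIm (rowC x) = 0.
Proof. by apply/rowP => j; rewrite !mxE. Qed.

Lemma rowRe_rowC (x : 'rV[R]_n) : rowRe (rowC x) = x.
Proof. by apply/rowP => j; rewrite !mxE. Qed.

Lemma rowRe_realZ (a : R) (u : 'rV[R[i]]_n) : rowRe (a%:C *: u) = a *: rowRe u.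
Proof.
by apply/rowP => j; rewrite !mxE; case: (u 0 j) => b c /=; rewrite mul0r subr0.
Qed.

Lemma rowRe0 : rowRe (0 : 'rV[R[i]]_n) = 0.
Proof. by apply/rowP => j; rewrite !mxE. Qed.

Lemma rowIm0 : rowIm (0 : 'rV[R[i]]_n) = 0.
Proof. by apply/rowP => j; rewrite !mxE. Qed.

Lemma rowRe_continuous : continuous (@rowRe R n).
Proof.
move=> u; apply: rV_continuous => j.
rewrite (_ : (fun _ => _) = @complex.Re R \o (fun w : 'rV[R[i]]_n => w 0 j)).
  apply: continuous_comp; [exact: coord_continuous|exact: Re_continuous].
by apply/funext => w; rewrite mxE.
Qed.

Lemma rowIm_continuous : continuous (@rowIm R n).
Proof.
move=> u; apply: rV_continuous => j.
rewrite (_ : (fun _ => _) = @complex.Im R \o (fun w : 'rV[R[i]]_n => w 0 j)).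
  apply: continuous_comp; [exact: coord_continuous|exact: Im_continuous].
by apply/funext => w; rewrite mxE.
Qed.

Lemma rowC_continuous : continuous (@rowC R n).
Proof.
move=> u; apply: rV_continuous => j.
rewrite (_ : (fun _ => _) = real_complex R \o (fun w : 'rV[R]_n => w 0 j)).
  apply: continuous_comp; [exact: coord_continuous|exact: real_complex_continuous].
by apply/funext => w; rewrite mxE.
Qed.

Lemma complexifyE (x : 'rV[R]_(n + n)) :
  complexify x = rowC (lsubmx x) + 'i *: rowC (rsubmx x).
Proof.
apply/rowP => j; rewrite !mxE; apply/eqP; rewrite eq_complex /=.
by rewrite !(mul0r, mul1r, mulr0, subr0, add0r, addr0) !eqxx.
Qed.

Lemma NiiZ (z : 'rV[R[i]]_n) : - 'i *: ('i *: z) = z.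
Proof. by rewrite scalerA mulNr -expr2 sqr_i opprK scale1r. Qed.

End ComplexRows.

(** * Hermitian maps and the orbit invariant *)

Section Hermitian.
Context {R : realType} {N M : nat}.
Context (Q : 'rV[R[i]]_M -> 'rV[R[i]]_M -> 'rV[R[i]]_N).
Context (hQ : hermitian_map Q).
Implicit Types (u v w : 'rV[R[i]]_M).

Lemma herm_sym u v : Q v u = rowconj (Q u v).
Proof. by have [_ _] := hQ; apply. Qed.

Lemma hermDl u u' v : Q (u + u') v = Q u v + Q u' v.
Proof. by have [H _ _] := hQ; have := H 1 u u' v; rewrite !scale1r. Qed.

Lemma herm0l v : Q 0 v = 0.
Proof. by apply: (addrI (Q 0 v)); rewrite -hermDl !addr0. Qed.

Lemma hermZl a u v : Q (a *: u) v = a *: Q u v.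
Proof.
by have [H _ _] := hQ; have := H a u 0 v; rewrite herm0l !addr0.
Qed.

Lemma hermNl u v : Q (- u) v = - Q u v.
Proof. by rewrite -scaleN1r hermZl scaleN1r. Qed.

Lemma hermDr u v v' : Q u (v + v') = Q u v + Q u v'.
Proof. by rewrite herm_sym hermDl rowconjD -!herm_sym. Qed.

Lemma herm0r v : Q v 0 = 0.
Proof. by apply: (addrI (Q v 0)); rewrite -hermDr !addr0. Qed.

Lemma hermZr a u v : Q u (a *: v) = conjc a *: Q u v.
Proof. by rewrite herm_sym hermZl rowconjZ -herm_sym. Qed.

Lemma hermNr u v : Q u (- v) = - Q u v.
Proof. by rewrite herm_sym hermNl rowconjN -herm_sym. Qed.

Lemma herm_linear v : linear (fun u => Q u v).
Proof. by move=> a u u'; rewrite hermDl hermZl. Qed.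

Lemma herm_continuous : continuous (fun u => Q u u).
Proof.
move=> u.
(* Expanding the first argument in the standard basis leaves coordinates times conjugates of linear
   maps. *)
rewrite (_ : (fun u => Q u u) = fun u => \sum_j u 0 j *: rowconj (Q u (delta_mx 0 j))).
  apply: (@cvg_finsum _ _ _ (nbhs u)) => j; apply: cvgZ; first exact: coord_continuous.
  apply: (@continuous_comp _ _ _ (fun w => Q w (delta_mx 0 j)) (@rowconj R N)).
    exact: (rV_linear_continuous (herm_linear _)).
  exact: rowconj_continuous.
apply/funext => w.
pose L : {linear 'rV[R[i]]_M -> 'rV[R[i]]_N} :=
  HB.pack (fun u => Q u w) (GRing.isLinear.Build _ _ _ _ _ (herm_linear w)).
have -> : Q w w = L (\sum_j w 0 j *: delta_mx 0 j) by rewrite -row_sum_delta.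
rewrite linear_sum; apply: eq_bigr => j _.
by rewrite linearZ /= -herm_sym.
Qed.

Lemma rowRe_herm_sym u v : rowRe (Q v u) = rowRe (Q u v).
Proof. by rewrite herm_sym rowRe_conj. Qed.

Definition level (p : 'rV[R[i]]_N * 'rV[R[i]]_M) : 'rV[R]_N :=
  rowIm p.1 - rowRe (Q p.2 p.2).

(** The terms [2 Re Q(u, w) + Re Q(w, w)] added to [Im z] are those gained by [Re Q(u, u)] when [u]
    becomes [u + w]. *)
Lemma level_heis x w p : level (heis Q x w p) = level p.
Proof.
rewrite /level /heis /= !rowImD rowIm_rowC addr0 -scalerA rowIm_iZ.
rewrite (_ : rowIm (2 *: _) = 2 *: rowRe (Q p.2 w)); last first.
  by rewrite !scaler_nat mulr2n rowImD rowIm_iZ mulr2n.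
rewrite !hermDl !hermDr !rowReD (rowRe_herm_sym p.2 w) scaler_nat mulr2n.
by apply/rowP => j; rewrite !mxE; ring.
Qed.

(** Moving [p] by [q.2 - p.2] makes the second components agree. Equality of levels then makes the
    imaginary parts of the first components agree, and a real translation does the rest. *)
Lemma heis_level_orbit p q : level q = level p ->
  exists x, q = heis Q x (q.2 - p.2) p.
Proof.
move=> lev; pose q0 := heis Q 0 (q.2 - p.2) p.
have q02 : q0.2 = q.2 by rewrite /q0 /heis /= addrC subrK.
exists (rowRe q.1 - rowRe q0.1); rewrite [LHS]surjective_pairing.
congr pair; last first.
  by rewrite /heis /= addrC subrK.
have -> : p.1 + rowC (rowRe q.1 - rowRe q0.1) + (2 * 'i) *: Q p.2 (q.2 - p.2) +
    'i *: Q (q.2 - p.2) (q.2 - p.2) = q0.1 + rowC (rowRe q.1 - rowRe q0.1).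
  rewrite /q0 /heis /= (_ : rowC 0 = 0) ?addr0; last by apply/rowP => j; rewrite !mxE.
  by rewrite [RHS]addrAC [X in _ = X + _]addrAC.
have : level q0 = level q by rewrite level_heis.
rewrite /level q02 => /addIr; move: q0.1 => z0 Im0.
apply/rowP => j; move/rowP/(_ j) : Im0; rewrite !mxE.
case: (q.1 0 j) (z0 0 j) => a b [c d] /= ->.
by apply/eqP; rewrite eq_complex /= addr0 [c + _]addrC subrK !eqxx.
Qed.

End Hermitian.

(** * First-order behaviour of the involution at a fixed point *)

Section AntiholomorphicGerm.
Context {R : realType} {N M : nat}.
Context (Q : 'rV[R[i]]_M -> 'rV[R[i]]_M -> 'rV[R[i]]_N).
Context (hQ : hermitian_map Q).
Local Notation E := ('rV[R[i]]_N * 'rV[R[i]]_M)%type.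
Local Notation normc := (@ComplexField.Normc.normc R).
Implicit Types (p h : E).

Lemma derive_cvg (b : E -> E) p h : differentiable b p ->
  z^-1 *: (b (z *: h + p) - b p) @[z --> 0^'] --> 'D_h b p.
Proof. by move=> /(@diff_derivable _ _ _ b p h). Qed.

Lemma line_continuous h p : continuous (fun z : R[i] => z *: h + p).
Proof.
move=> z; apply: (@cvgD _ _ _ (nbhs z)); last exact: cvg_cst.
exact: scalel_continuous.
Qed.

Lemma snd_cvg (x : E) : y.2 @[y --> x] --> x.2.
Proof. by apply: (@cvg_snd _ _ (nbhs x.1) (nbhs x.2)). Qed.

Lemma near_line (U : set E) p h : open U -> U p ->
  \forall z \near (0 : R[i]), U (z *: h + p).
Proof.
move=> oU Up; have := @line_continuous h p 0.
rewrite /continuous_at scale0r add0r => /(_ U); apply.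
by apply: open_nbhs_nbhs; split.
Qed.

Lemma herm_normc (z : R[i]) (u : 'rV[R[i]]_M) :
  Q (z *: u) (z *: u) = (normc z ^+ 2)%:C *: Q u u.
Proof.
rewrite (hermZl hQ) (hermZr hQ) scalerA; congr (_ *: _).
by rewrite -sqr_normc rmorphXn.
Qed.

Lemma normc_conj (z : R[i]) : normc (conjc z) = normc z.
Proof. by apply: (@complexI R); exact: (normcJ z). Qed.

Lemma conjc_semilinear (a x y : R[i]) :
  conjc (conjc a * x + y) = a * conjc x + conjc y.
Proof. by rewrite rmorphD rmorphM; congr (_ * _ + _); exact: conjcK. Qed.

Lemma rowRe_herm_add (d u : 'rV[R[i]]_M) : rowRe (Q (d + u) (d + u)) =
  rowRe (Q d d) + 2 *: rowRe (Q d u) + rowRe (Q u u).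
Proof.
rewrite (hermDl hQ) !(hermDr hQ) !rowReD (rowRe_herm_sym hQ d u) scaler_nat mulr2n.
by rewrite !addrA.
Qed.

Lemma herm_entry_continuous j : continuous (fun u => rowRe (Q u u) 0 j).
Proof.
move=> u; rewrite (_ : (fun _ => _) =
    (complex.Re (R:=R) \o (fun v : 'rV[R[i]]_N => v 0 j)) \o (fun u => Q u u)).
  apply: continuous_comp; first exact: herm_continuous.
  by apply: continuous_comp; [exact: coord_continuous|exact: Re_continuous].
by apply/funext => v; rewrite /= mxE.
Qed.

(* After multiplying by [- 'i] and adding holomorphic terms, the preserved level
   becomes the real part of a holomorphic function of [z] whose second order
   behaviour at [0] is governed by [Q]. *)
Lemma germ_preserves_herm (U : set E) (b : E -> E) p h :
  open U -> U p -> (forall q, U q -> differentiable b q) ->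
  rowconj (b p).2 = p.2 ->
  (forall q, U q -> level Q (cspaceconj (b q)) = level Q q) ->
  let T := rowconj ('D_h b p).2 in rowRe (Q T T) = rowRe (Q h.2 h.2).
Proof.
move=> oU Up db fixp lev T; apply/rowP => j.
pose l z := z *: h + p.
(* The real part of [- 'i * x.1 0 j] is an imaginary part, as in the level. The other summands carry
   the terms of [Q] linear in the deviation from [p.2]; the double conjugation makes [L1] complex
   linear. *)
pose L1 (x : E) : R[i] := - 'i * x.1 0 j + 2 * conjc (Q (rowconj x.2) p.2 0 j).
pose L2 (x : E) : R[i] := - 'i * x.1 0 j - 2 * Q x.2 p.2 0 j.
pose f z := L1 (b (l z)) + L2 (l z).
have lin1 : linear L1.
  move=> a x y; rewrite /L1 /= rowconjD rowconjZ (hermDl hQ) (hermZl hQ) !mxE.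
  rewrite conjc_semilinear.
  by rewrite /GRing.scale /=; ring.
have lin2 : linear L2.
  move=> a x y; rewrite /L2 /= (hermDl hQ) (hermZl hQ) !mxE.
  by rewrite /GRing.scale /=; ring.
have nearU : \forall z \near (0 : R[i]), U (l z) by exact: near_line.
have dl z : differentiable l z.
  have ll : linear (fun z : R[i] => z *: h) by move=> a x y; rewrite scalerDl scalerA.
  have cl : continuous (fun z : R[i] => z *: h).
    exact: scalel_continuous.
  have [? _] := linear_is_diff z ll cl.
  by apply: differentiableD => //; exact: differentiable_cst.
have dL1 x : differentiable L1 x.
  by have [] := linear_is_diff x lin1 (pair_linear_continuous lin1).
have dL2 x : differentiable L2 x.
  by have [] := linear_is_diff x lin2 (pair_linear_continuous lin2).
have df : \forall z \near (0 : R[i]), differentiable f z.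
  apply: filterS nearU => z Uz; apply: differentiableD.
    exact: (differentiable_comp (differentiable_comp (dl z) (db _ Uz)) (dL1 _)).
  exact: (differentiable_comp (dl z) (dL2 _)).
(* Equality of levels, expanded about [p.2]: constant and linear terms are absorbed in [f], and the
   two quadratic terms are left. *)
have Ref z : U (l z) -> complex.Re (f z) =
    normc z ^+ 2 * rowRe (Q h.2 h.2) 0 j
    - rowRe (Q (rowconj (b (l z) - b p).2) (rowconj (b (l z) - b p).2)) 0 j.
  move=> Uz; set d := rowconj _.
  have ed : rowconj (b (l z)).2 = d + p.2.
    by rewrite /d /= rowconjD rowconjN fixp subrK.
  have := lev _ Uz; rewrite /level /= ed rowIm_conj !rowRe_herm_add.
  rewrite herm_normc rowRe_realZ => /rowP/(_ j).
  rewrite /f /L1 /L2 ed (hermDl hQ).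
  rewrite [Q (l z).2 _](_ : _ = Q (z *: h.2) p.2 + Q p.2 p.2); last first.
    by rewrite /l /= (hermDl hQ).
  rewrite /l /= !mxE.
  case: (Q p.2 p.2 0 j) => a1 b1; case: (Q d p.2 0 j) => a2 b2.
  case: (Q d d 0 j) => a3 b3; case: (Q (z *: h.2) p.2 0 j) => a4 b4.
  case: ((b _).1 0 j) => a5 b5; case: (Q h.2 h.2 0 j) => a6 b6.
  case: (p.1 0 j) => a7 b7; case: (h.1 0 j) => a8 b8.
  case: z Uz @d ed => z1 z2 _ _ _ /=.
  rewrite !(mul0r, mulr0, mul1r, mulr1, subr0, add0r, addr0, sub0r, oppr0).
  move=> H; lra.
have cD : rowconj (z^-1 *: (b (l z) - b p)).2 @[z --> (0 : R[i])^'] --> T.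
  apply: (@cvg_comp _ _ _ _ (@rowconj R M)); last exact: rowconj_continuous.
  apply: (@cvg_comp _ _ _ (fun z => z^-1 *: (b (l z) - b p)) snd);
    last exact: snd_cvg.
  exact: derive_cvg (db _ Up).
(* Off [0] this function is the real part of [f z] divided by the squared modulus of [z], so
   [holo_quadratic] forces its limit to be zero. *)
have cq : rowRe (Q h.2 h.2) 0 j - rowRe (Q (rowconj (z^-1 *: (b (l z) - b p)).2)
     (rowconj (z^-1 *: (b (l z) - b p)).2)) 0 j @[z --> (0 : R[i])^'] -->
   rowRe (Q h.2 h.2) 0 j - rowRe (Q T T) 0 j.
  apply: cvgB; first exact: cvg_cst.
  apply: (@cvg_comp _ _ _ _ (fun u => rowRe (Q u u) 0 j) _ (nbhs T)) => //.
  exact: herm_entry_continuous.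
apply/eqP; rewrite eq_sym -subr_eq0; apply/eqP.
apply: (holo_quadratic df).
  have l0 : l 0 = p by rewrite /l scale0r add0r.
  rewrite Ref l0// subrr ComplexField.Normc.normc0 expr0n mul0r sub0r.
  rewrite (_ : rowconj _ = 0) ?(herm0l hQ) ?mxE ?oppr0//.
  by apply/rowP => k; rewrite !mxE conjc0.
apply: cvg_trans cq; apply: near_eq_cvg.
near=> z.
have z0 : z != 0 by near: z; exact: nbhs_dnbhs_neq.
have Uz : U (l z) by near: z; apply: nbhs_dnbhs; exact: nearU.
have nz : normc z ^+ 2 != 0.
  rewrite expf_neq0//; apply: contraNneq z0 => /ComplexField.Normc.eq0_normc ->.
  by [].
rewrite Ref//.
have -> : rowconj (b (l z) - b p).2 = conjc z *: rowconj (z^-1 *: (b (l z) - b p)).2.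
  by rewrite -rowconjZ /= scalerA mulfV// scale1r.
rewrite herm_normc normc_conj rowRe_realZ; move: nz.
by rewrite [(_ *: rowRe _) 0 j]mxE; move: (normc z ^+ 2) => a a0; field.
Unshelve. all: by end_near. Qed.

(** The displacement vanishes at [p], so along [h] its real difference quotients are displacements
    scaled by [t^-1]; they lie in [W], which is closed. *)
Lemma germ_moves_in_subspace (U : set E) (W : set 'rV[R[i]]_M) (b : E -> E) p h :
  open U -> U p -> differentiable b p -> real_subspace W ->
  rowconj (b p).2 = p.2 ->
  (forall q, U q -> W (rowconj (b q).2 - q.2)) ->
  W (rowconj ('D_h b p).2 - h.2).
Proof.
move=> oU Up db sW fixp mov.
pose u (z : R[i]) := rowconj (z^-1 *: (b (z *: h + p) - b p)).2 - h.2.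
have cu : u z @[z --> 0^'] --> rowconj ('D_h b p).2 - h.2.
  apply: cvgB; last exact: cvg_cst.
  apply: (@cvg_comp _ _ _ _ (@rowconj R M)); last exact: rowconj_continuous.
  apply: (@cvg_comp _ _ _ (fun z => z^-1 *: (b (z *: h + p) - b p)) snd);
    last exact: snd_cvg.
  exact: derive_cvg.
(* The parameter is restricted to the reals because [W] is assumed stable only under real
   scaling. *)
have c0 : real_complex R t @[t --> (0 : R)^'] --> (0 : R[i])^'.
  apply: (@continuous_injective_withinNx _ _ (real_complex R) 0).
    exact: real_complex_continuous.
  by move=> y /complexI.
have cr := cvg_comp _ _ c0 cu.
apply: (closed_cvg W (real_subspace_closed sW) _ _ cr).
near=> t.
have t0 : t != 0 by near: t; exact: nbhs_dnbhs_neq.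
have Ut : U (t%:C *: h + p).
  by near: t; exact: (c0 _ (nbhs_dnbhs (near_line h oU Up))).
have -> : (u \o real_complex R) t =
    t^-1%:C *: (rowconj (b (t%:C *: h + p)).2 - (t%:C *: h + p).2) + 0.
  have tc : t%:C != 0 by rewrite (inj_eq (@complexI R)).
  rewrite addr0 /u /= rowconjZ rowconjD rowconjN fixp.
  have -> : conjc (t%:C)^-1 = t^-1%:C by rewrite -fmorphV conjc_real.
  have -> : rowconj (b (t%:C *: h + p)).2 - (t%:C *: h.2 + p.2) =
      rowconj (b (t%:C *: h + p)).2 - p.2 - t%:C *: h.2.
    by rewrite opprD addrA addrAC.
  by rewrite [RHS]scalerBr scalerA fmorphV mulVf// scale1r.
by have [W0 WD] := sW; apply: WD => //; exact: mov.
Unshelve. all: by end_near. Qed.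

Lemma norm_rowconj n (x : 'rV[R[i]]_n) : `|rowconj x| = `|x|.
Proof.
rewrite /Num.norm /= !mx_normE; congr (_%:num).
by apply: eq_bigr => k _; apply/val_inj; rewrite /= mxE normcJ.
Qed.

Lemma norm_cspaceconj (x : E) : `|cspaceconj x| = `|x|.
Proof. by rewrite !prod_normE /= !norm_rowconj. Qed.

Lemma cspaceconjK : involutive (@cspaceconj R N M).
Proof. by case=> z u; rewrite /cspaceconj /= !rowconjK. Qed.

Lemma cspaceconjD (x y : E) : cspaceconj (x + y) = cspaceconj x + cspaceconj y.
Proof. by rewrite /cspaceconj /= !rowconjD. Qed.

Lemma cspaceconjN (x : E) : cspaceconj (- x) = - cspaceconj x.
Proof. by rewrite /cspaceconj /= !rowconjN. Qed.

Lemma cspaceconjZ (a : R[i]) (x : E) : cspaceconj (a *: x) = conjc a *: cspaceconj x.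
Proof. by rewrite /cspaceconj /= !rowconjZ. Qed.

Lemma cspaceconj_continuous : continuous (@cspaceconj R N M).
Proof.
move=> x; apply/(@cvgrPdist_lt _ _ _ (nbhs x)) => e e0.
near=> y; rewrite -cspaceconjN -cspaceconjD norm_cspaceconj.
by near: y; exact: (@cvgr_dist_lt _ _ _ _ _ id x cvg_id).
Unshelve. all: by end_near. Qed.

(** Conjugating [b] on both sides gives a map [g], complex differentiable at [b p], with [g \o b]
    the identity near [p]; the complex chain rule then applies. *)
Lemma germ_derivative_involutive (b : E -> E) p h :
  differentiable b p -> cspaceconj (b p) = p ->
  (\forall q \near p, cspaceconj (b (cspaceconj (b q))) = q) ->
  cspaceconj ('D_(cspaceconj ('D_h b p)) b p) = h.
Proof.
move=> db fixp inv.
pose g := @cspaceconj R N M \o b \o @cspaceconj R N M.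
pose dg := @cspaceconj R N M \o 'd b p \o @cspaceconj R N M.
have bp : b p = cspaceconj p by rewrite -[in RHS]fixp cspaceconjK.
have ldg : linear dg.
  move=> a x y; rewrite /dg /= cspaceconjD cspaceconjZ linearP.
  rewrite cspaceconjD cspaceconjZ; congr (_ *: _ + _); exact: conjcK.
have is_dg : is_diff (b p) g dg.
  apply: approx_is_diff => //; first exact: pair_linear_continuous.
  move=> e e0; have H := diff_approx db e0.
  have cc : cspaceconj x @[x --> (0 : E)] --> (0 : E).
    have := @cspaceconj_continuous 0.
    rewrite /continuous_at (_ : cspaceconj 0 = 0)//.
    by apply: (addrI (cspaceconj 0)); rewrite -cspaceconjD !addr0.
  near=> k.
  have : `|b (cspaceconj k + p) - b p - 'd b p (cspaceconj k)| <= e * `|cspaceconj k|.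
    by near: k; exact: (cc _ H).
  rewrite /g /dg /= norm_cspaceconj bp cspaceconjK cspaceconjD cspaceconjK => H'.
  by rewrite -!cspaceconjN -!cspaceconjD norm_cspaceconj bp.
have E1 : 'D_h (g \o b) p = h.
  rewrite (@near_eq_derive _ _ _ (g \o b) id) ?derive_id//.
by rewrite (deriveE _ db) -[RHS]E1 (derive_comp_is_diff h db is_dg).
Unshelve. all: by end_near. Qed.

End AntiholomorphicGerm.

(** * From strong visibility to a real form *)

Section Forward.
Context {R : realType} {N M : nat}.
Context (Q : 'rV[R[i]]_M -> 'rV[R[i]]_M -> 'rV[R[i]]_N).
Context (hQ : hermitian_map Q).
Local Notation E := ('rV[R[i]]_N * 'rV[R[i]]_M)%type.

Lemma heis_orbitP (W : set 'rV[R[i]]_M) (p q : E) :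
  act_orbit (heis_group Q W) p q <-> level Q q = level Q p /\ W (q.2 - p.2).
Proof.
split=> [[_ [x [w [Ww ->]]] <-]|[/(heis_level_orbit hQ)[x qE] Wqp]].
  by rewrite level_heis//= [_ + w]addrC addrK.
by exists (heis Q x (q.2 - p.2)) => //; exists x, (q.2 - p.2).
Qed.

Lemma heis_orbit_refl (W : set 'rV[R[i]]_M) (p : E) : real_subspace W ->
  act_orbit (heis_group Q W) p p.
Proof. by move=> [W0 _]; apply/heis_orbitP; rewrite subrr. Qed.

Lemma cone_positive_eq0 (Om : set 'rV[R]_N) u : cone_positive Om Q ->
  rowRe (Q u u) = 0 -> u = 0.
Proof.
move=> pos; have [->//|u0] := eqVneq u 0.
have [y [_ /= y0] <-] := pos _ u0.
by rewrite rowRe_rowC.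
Qed.

(** Antilinearity makes multiplication by ['i] exchange the two eigenspaces of [t], so the splitting
    into eigenvectors is the splitting along [W0] and ['i W0]. *)
Lemma antilinear_involution_real_form (t : 'rV[R[i]]_M -> 'rV[R[i]]_M)
    (W0 := [set u | t u = - u]) :
  (forall a u v, t (a *: u + v) = conjc a *: t u + t v) ->
  (forall u, t (t u) = u) ->
  (forall u, rowRe (Q (t u) (t u)) = rowRe (Q u u)) ->
  real_form W0 /\ forall u v, W0 u -> W0 v -> rowIm (Q u v) = 0.
Proof.
move=> tl tt tQ.
have tD u v : t (u + v) = t u + t v.
  by have := tl 1 u v; rewrite rmorph1 !scale1r.
have t0 : t 0 = 0 by apply: (addrI (t 0)); rewrite -tD !addr0.
have tZ a u : t (a *: u) = conjc a *: t u.
  by have := tl a u 0; rewrite t0 !addr0.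
have tN u : t (- u) = - t u by rewrite -scaleN1r tZ rmorphN1 scaleN1r.
have ti u : t ('i *: u) = - ('i *: t u).
  rewrite tZ -scaleNr; congr (_ *: _).
  by apply/eqP; rewrite eq_complex /= oppr0 !eqxx.
have ii (u : 'rV[R[i]]_M) : 'i *: ('i *: u) = - u.
  by rewrite scalerA -expr2 sqr_i scaleN1r.
have half (u : 'rV[R[i]]_M) : 2^-1%:C *: u + 2^-1%:C *: u = u.
  by rewrite -scalerDl -rmorphD /= -div1r -splitr scale1r.
split; first split.
- split; first by rewrite /W0 /= t0 oppr0.
  move=> a u v /= Wu Wv.
  by rewrite /W0 /= tl Wu Wv conjc_real scalerN -opprD.
- move=> u; exists (2^-1%:C *: (u - t u)), (2^-1%:C *: (- 'i *: (u + t u))); split.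
  + by rewrite /W0 /= tZ tD tN tt conjc_real -scalerN opprB addrC.
  + rewrite /W0 /= tZ conjc_real scaleNr tN ti tD tt opprK.
    by rewrite scalerN opprK [t u + u]addrC.
  + rewrite [in RHS]scalerA mulrC -scalerA scaleNr [in RHS]scalerN ii opprK.
    by rewrite -scalerDr addrACA addNr addr0 scalerDr half.
- move=> w w' Ww Ww' wE.
  have : t w = w by rewrite {1}wE ti Ww' scalerN opprK -wE.
  rewrite Ww => /eqP; rewrite eq_sym -addr_eq0 -mulr2n -scaler_nat scaler_eq0.
  by rewrite pnatr_eq0 => /= /eqP.
move=> u v Wu Wv.
have polar x y : rowRe (Q (t x) (t y)) = rowRe (Q x y).
  have := tQ (x + y); rewrite tD !(rowRe_herm_add hQ) !tQ => /addIr/addrI.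
  by move/(scalerI (_ : 2 != 0)); apply; rewrite pnatr_eq0.
(* [t] negates [u] and fixes ['i *: v], so the real part of [Q u ('i *: v)] equals its own opposite;
   this real part is [rowIm (Q u v)]. *)
have := polar u ('i *: v); rewrite ti Wu Wv scalerN opprK (hermNl hQ).
have -> : Q u ('i *: v) = - ('i *: Q u v).
  rewrite (hermZr hQ) -scaleNr; congr (_ *: _).
  by apply/eqP; rewrite eq_complex /= oppr0 !eqxx.
rewrite opprK -scalerN !rowRe_iZ => /eqP.
have -> : rowIm (- Q u v) = - rowIm (Q u v) by apply/rowP => j; rewrite !mxE raddfN.
rewrite opprK eq_sym -addr_eq0 -mulr2n -scaler_nat scaler_eq0.
by rewrite pnatr_eq0 => /= /eqP.
Qed.

Lemma strongly_visible_real_form (Om : set 'rV[R]_N) (W : set 'rV[R[i]]_M) :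
  cone_positive Om Q -> real_subspace W ->
  strongly_visible_involutive (siegel_domain Om Q) (heis_group Q W) ->
  exists W0 : set 'rV[R[i]]_M,
    [/\ W0 `<=` W, real_form W0
      & forall u v, W0 u -> W0 v -> rowIm (Q u v) = 0].
Proof.
move=> pos sW [S [D [s [[prev [s' [[sD _] _ _ hs _]] fixS orb] ss]]]].
have [_ _ [oD [p0 Dp0]] invD meet] := prev.
(* The slice meets the orbit of [p0], and invariance of [D] keeps the meeting point inside [D],
   where [s] fixes it. *)
have [p [Sp [g Hg gp]]] := meet _ Dp0.
have Dp : D p by rewrite -gp; exact: invD.
have sp : s p = p by exact: fixS.
pose b := @cspaceconj R N M \o s.
have bK q : cspaceconj (b q) = s q by rewrite /b /= cspaceconjK.
have b2 q : rowconj (b q).2 = (s q).2 by rewrite -[LHS]/((cspaceconj (b q)).2) bK.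
have sorb q : D q -> level Q (s q) = level Q q /\ W ((s q).2 - q.2).
  move=> Dq; apply/heis_orbitP; rewrite -(orb _ Dq).
  by exists q => //; exact: heis_orbit_refl.
pose T h := rowconj ('D_h b p).2.
have db : differentiable b p by exact: hs.
have Tl a h k : T (a *: h + k) = conjc a *: T h + T k.
  by rewrite /T !(deriveE _ db) linearP /= rowconjD rowconjZ.
have TQ h : rowRe (Q (T h) (T h)) = rowRe (Q h.2 h.2).
  apply: (@germ_preserves_herm _ _ _ _ hQ D b p h oD Dp hs); first by rewrite b2 sp.
  by move=> q /sorb[+ _]; rewrite bK.
have TW h : W (T h - h.2).
  apply: (germ_moves_in_subspace h oD Dp db sW); first by rewrite b2 sp.
  by move=> q /sorb[_]; rewrite b2.
have Tinv h : T (cspaceconj ('D_h b p)) = h.2.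
  rewrite -[RHS]/(snd h) -[in RHS](germ_derivative_involutive h db)//.
    by rewrite bK.
  have : \forall q \near p, D q by exact: open_nbhs_nbhs.
  by apply: filterS => q Dq; rewrite bK /b /= cspaceconjK ss.
have T0 : T 0 = 0.
  by apply: (addrI (T 0)); have := Tl 1 0 0; rewrite rmorph1 !scale1r !addr0.
pose t u := T (0, u).
have Tt h : T h = t h.2.
  have T1 : T (h.1, 0) = 0.
    by apply: (cone_positive_eq0 pos); rewrite TQ /= (herm0l hQ) rowRe0.
  have := Tl 1 (h.1, 0) (0, h.2); rewrite rmorph1 !scale1r T1 add0r /t => <-.
  by congr T; rewrite [LHS]surjective_pairing; congr pair; rewrite /= ?addr0 ?add0r.
have tl a u v : t (a *: u + v) = conjc a *: t u + t v.
  by rewrite /t -Tl; congr T; congr pair; rewrite /= scaler0 addr0.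
have tt u : t (t u) = u.
  by rewrite -[RHS](Tinv (0, u)) Tt.
have tQ u : rowRe (Q (t u) (t u)) = rowRe (Q u u) by exact: TQ (0, u).
exists [set u | t u = - u].
have [rf ImQ] := antilinear_involution_real_form tl tt tQ.
split => // u tu; have [W0 WD] := sW.
(* When [t u = - u], the element [t u - u] of [W] is [- 2 u], and scaling it by [- 2^-1] recovers
   [u]. *)
have := WD (- 2^-1) _ _ (TW (0, u)) W0.
rewrite /= -/(t u) tu -opprD rmorphN scaleNr scalerN opprK addr0.
by rewrite scalerDr -scalerDl -rmorphD /= -div1r -splitr scale1r.
Qed.

End Forward.

(** * Smoothness of linear maps *)

Section SmoothLinear.
Context {R : realType} {U V : normedModType R}.

Lemma class_C_cst k (A : set U) (c : V) : class_C k A (fun=> c).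
Proof.
elim: k c => [|k IH] c /=; first by move=> x _; apply: cvg_cst.
split=> [x _|v]; first exact: differentiable_cst.
rewrite (_ : (fun _ => _) = fun=> 0); first exact: IH.
by apply/funext => x; rewrite diff_cst.
Qed.

Lemma smooth_linear (A : set U) (f : U -> V) : linear f -> continuous f ->
  smooth_on A f.
Proof.
move=> lf cf [|k] /=; first by move=> x _; exact: cf.
split=> [x _|v]; first by have [] := linear_is_diff x lf cf.
rewrite (_ : (fun _ => _) = fun=> f v); first exact: class_C_cst.
by apply/funext => x; have [_ ->] := linear_is_diff x lf cf.
Qed.

End SmoothLinear.

(** * From a real form to strong visibility *)

Section Backward.
Context {R : realType} {N M : nat}.
Local Notation E := ('rV[R[i]]_N * 'rV[R[i]]_M)%type.

Lemma fst_continuous : continuous (fun x : E => x.1).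
Proof. by move=> x; apply: (@cvg_fst _ _ (nbhs x.1) (nbhs x.2)). Qed.

Lemma snd_continuous : continuous (fun x : E => x.2).
Proof. by move=> x; exact: snd_cvg. Qed.

Lemma level_continuous (Q : 'rV[R[i]]_M -> 'rV[R[i]]_M -> 'rV[R[i]]_N) :
  hermitian_map Q -> continuous (level Q).
Proof.
move=> hQ p; rewrite /level; apply: (@cvgB _ _ _ (nbhs p)).
  apply: (@continuous_comp _ _ _ (fun x : E => x.1) (@rowIm R N)).
    exact: fst_continuous.
  exact: rowIm_continuous.
apply: (@continuous_comp _ _ _ (fun x : E => Q x.2 x.2) (@rowRe R N)).
  apply: (@continuous_comp _ _ _ (fun x : E => x.2) (fun u => Q u u)).
    exact: snd_continuous.
  exact: herm_continuous.
exact: rowRe_continuous.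
Qed.

Lemma siegel_open (Om : set 'rV[R]_N) Q : open Om -> hermitian_map Q ->
  open (@siegel_domain R N M Om Q).
Proof.
by move=> oOm hQ; apply: open_comp => // p _; exact: level_continuous.
Qed.

(* [k] vectors spanning the real subspace [W0] parametrize [i R^N + i W0] *)
Section Slice.
Context {k : nat} (A : 'M[R]_(k, M + M)).
Context (fA : row_free A).

Definition slice_param (x : 'rV[R]_(N + k)) : E :=
  ('i *: rowC (lsubmx x), 'i *: complexify (rsubmx x *m A)).

(** A left inverse of [slice_param] defined on the whole ambient space; its continuity makes the
    parametrization a homeomorphism onto its image. *)
Definition slice_coord (p : E) : 'rV[R]_(N + k) :=
  row_mx (rowIm p.1) (realify (- 'i *: p.2) *m pinvmx A).

Lemma slice_paramK : cancel slice_param slice_coord.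
Proof.
move=> x; rewrite /slice_coord /slice_param /= NiiZ complexifyK rowIm_iZ rowRe_rowC.
by rewrite -mulmxA mulmxVp// mulmx1 hsubmxK.
Qed.

Lemma slice_param_continuous : continuous slice_param.
Proof.
have iZ n (f : 'rV[R]_(N + k) -> 'rV[R]_n) : continuous f ->
    continuous (fun y => 'i *: rowC (f y)).
  move=> cf x; apply: (@cvgZl_tmp _ _ _ (nbhs x)).
  exact: (@continuous_comp _ _ _ f (@rowC R n) x (cf x) (@rowC_continuous R n _)).
have cA (f : 'rV[R]_(M + M) -> 'rV[R]_M) : linear f ->
    continuous (fun y : 'rV[R]_(N + k) => f (rsubmx y *m A)).
  move=> lf; apply: rV_linear_continuous => a y z.
  by rewrite linearP mulmxDl -scalemxAl lf.
move=> x; apply: (@cvg_pair _ _ _ (nbhs x) (nbhs (slice_param x).1)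
  (nbhs (slice_param x).2) _ _ _
  (fun y => (slice_param y).1) (fun y => (slice_param y).2)).
  by apply: iZ; exact: continuous_lsubmx.
rewrite (_ : (fun _ => _) = fun y => 'i *: rowC (lsubmx (rsubmx y *m A)) +
    'i *: ('i *: rowC (rsubmx (rsubmx y *m A)))); last first.
  by apply/funext => y; rewrite /slice_param /= complexifyE scalerDr.
rewrite /slice_param /= complexifyE scalerDr.
apply: (@cvgD _ _ _ (nbhs x)); last apply: (@cvgZl_tmp _ _ _ (nbhs x)).
  by apply: (iZ _ (fun y => lsubmx (rsubmx y *m A))); apply: cA => a y z; rewrite linearP.
by apply: (iZ _ (fun y => rsubmx (rsubmx y *m A))); apply: cA => a y z; rewrite linearP.
Qed.

Lemma slice_coord_continuous : continuous slice_coord.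
Proof.
move=> p; apply: rV_continuous => j; case: (split_ordP j) => l ->.
  rewrite (_ : (fun _ => _) = (fun v : 'rV[R]_N => v 0 l) \o
      (@rowIm R N \o (fun x : E => x.1))).
    apply: continuous_comp; last exact: coord_continuous.
    by apply: continuous_comp; [exact: fst_continuous|exact: rowIm_continuous].
  by apply/funext => x; rewrite /slice_coord row_mxEl.
rewrite (_ : (fun _ => _) = (fun v : 'rV[R]_(M + M) => (v *m pinvmx A) 0 l) \o
    (@realify R M \o (fun x : E => - 'i *: x.2))).
  apply: continuous_comp.
    apply: continuous_comp; last exact: realify_continuous.
    by apply: (@cvgZl_tmp _ _ _ (nbhs p)); exact: snd_continuous.
  apply: (@continuous_comp _ _ _ (fun v : 'rV[R]_(M + M) => v *m pinvmx A)
      (fun v : 'rV[R]_k => v 0 l)); last exact: coord_continuous.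
  by apply: rV_linear_continuous => a x y; rewrite mulmxDl -scalemxAl.
by apply/funext => x; rewrite /slice_coord row_mxEr.
Qed.

Lemma rcoord_slice_linear : linear (@rcoord R N M \o slice_param).
Proof.
move=> a x y; rewrite /rcoord /slice_param /= !rowRe_iZ !rowIm_iZ.
have addp (V W : lmodType R) (v v' : V) (w w' : W) :
  a *: (v, w) + (v', w') = (a *: v + v', a *: w + w') by [].
rewrite !addp !linearP /= !mulmxDl -!scalemxAl.
by congr ((_, _), (_, _)); apply/rowP => j; rewrite !mxE /=; ring.
Qed.

Lemma rcoord_slice_continuous : continuous (@rcoord R N M \o slice_param).
Proof. exact: (rV_linear_continuous rcoord_slice_linear). Qed.

Lemma rcoord0 : rcoord (0 : E) = 0.
Proof. by rewrite /rcoord /= !rowRe0 !rowIm0. Qed.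

Lemma rcoord_inj : injective (@rcoord R N M).
Proof.
have inj n (u v : 'rV[R[i]]_n) : rowRe u = rowRe v -> rowIm u = rowIm v -> u = v.
  move=> uv uv'; apply/rowP => j; move/rowP/(_ j) : uv; move/rowP/(_ j) : uv'.
  by rewrite !mxE; case: (u 0 j) (v 0 j) => a b [c d] /= -> ->.
move=> [z u] [z' u'] [h1 h2 h3 h4].
by congr pair; exact: inj.
Qed.

Lemma cstruct_rcoord (p : E) : cstruct (rcoord p) = rcoord ('i *: p).
Proof. by rewrite /cstruct /rcoord /= !rowRe_iZ !rowIm_iZ. Qed.

Lemma rcoord_slice_diff x :
  'd (@rcoord R N M \o slice_param) x = @rcoord R N M \o slice_param :> (_ -> _).
Proof.
by have [_ ->] := linear_is_diff x rcoord_slice_linear rcoord_slice_continuous.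
Qed.

(** One linear chart covers the slice. It is totally real because [i R^N] meets [R^N], and [W0]
    meets ['i W0], only in zero. *)
Lemma slice_submanifold (W0 : set 'rV[R[i]]_M) (D : set E) :
  (forall u, W0 u <-> (realify u <= A)%MS) -> 
  (forall w w', W0 w -> W0 w' -> w = 'i *: w' -> w = 0) -> open D ->
  totally_real_submanifold D
    [set p | D p /\ rowRe p.1 = 0 /\ exists2 w, W0 w & p.2 = 'i *: w].
Proof.
move=> HA real oD; split; first by move=> p [].
have W0A x : W0 (complexify (x *m A)) by apply/HA; rewrite complexifyK submxMl.
exists (N + k)%N => p [Dp _]; exists D, (slice_param @^-1` D), slice_param; split => //.
- split => //.
  + by apply: open_comp => // x _; exact: slice_param_continuous.
  + exact: smooth_linear rcoord_slice_linear rcoord_slice_continuous.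
  + move=> x _ v; rewrite rcoord_slice_diff => v0.
    rewrite -[v]slice_paramK.
    have -> : slice_param v = 0.
      by apply: rcoord_inj; rewrite [LHS]v0 rcoord0.
    by rewrite /slice_coord /realify /= scaler0 rowRe0 !rowIm0 row_mx0 mul0mx row_mx0.
  + split; last first.
      exists slice_coord; split; last by move=> x _; exact: slice_paramK.
      exact: continuous_subspaceT slice_coord_continuous.
    apply/seteqP; split=> [_ [x Dx <-]|q [[Dq [Re0 [w Ww q2]]] _]].
      split=> //; split=> //; split; first by rewrite /= rowRe_iZ rowIm_rowC oppr0.
      by exists (complexify (rsubmx x *m A)).
    have qE : slice_param (slice_coord q) = q.
      rewrite /slice_param /slice_coord row_mxKl row_mxKr [RHS]surjective_pairing.
      congr pair.
        apply/rowP => j; move/rowP/(_ j) : Re0; rewrite !mxE.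
        case: (q.1 0 j) => a b /= ->; apply/eqP.
        by rewrite eq_complex /= !(mul0r, mul1r, mulr0, oppr0, addr0, add0r) !eqxx.
      by rewrite q2 NiiZ mulmxKpV ?realifyK//; exact/HA.
    by exists (slice_coord q); rewrite /= ?qE.
- move=> x _; rewrite /totally_real_at rcoord_slice_diff => v w /=.
  rewrite cstruct_rcoord => /rcoord_inj vw.
  have v1 : (slice_param v).1 = 0.
    rewrite vw /=; apply/rowP => j; move/(congr1 (fun q : E => q.1 0 j)): vw.
    rewrite !mxE /= => /eqP; rewrite eq_complex /=.
    rewrite !(mul0r, mul1r, mulr0, mulr1, subr0, add0r, sub0r, addr0).
    by rewrite oppr0 eq_sym oppr_eq0 => /andP[/eqP -> _]; rewrite !mulr0.
  have v2 : (slice_param v).2 = 0.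
    move/(congr1 (fun q : E => - 'i *: q.2)): vw; rewrite /= !NiiZ => E2.
    by rewrite (real _ _ _ _ E2)// scaler0.
  by rewrite [slice_param v]surjective_pairing v1 v2 rcoord0.
Qed.

End Slice.

Lemma real_form_strongly_visible (Om : set 'rV[R]_N)
    (Q : 'rV[R[i]]_M -> 'rV[R[i]]_M -> 'rV[R[i]]_N) (W W0 : set 'rV[R[i]]_M) :
  regular_cone Om -> hermitian_map Q -> real_subspace W ->
  W0 `<=` W -> real_form W0 ->
  (forall u v, W0 u -> W0 v -> rowIm (Q u v) = 0) ->
  strongly_visible_involutive (siegel_domain Om Q) (heis_group Q W).
Proof.
move=> [[y0 Omy0] oOm _ _ _] hQ [W00 WD] W0W [sW0 W0gen W0real] ImQ.
have [W000 W0D] := sW0.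
have WB u v : W u -> W v -> W (u + v).
  by move=> Wu Wv; have := WD 1 _ _ Wu Wv; rewrite rmorph1 scale1r.
have W0Z (a : R) u : W0 u -> W0 (a%:C *: u).
  by move=> Wu; have := W0D a _ _ Wu W000; rewrite addr0.
have W0N u : W0 u -> W0 (- u).
  by move=> /(W0Z (-1)); rewrite rmorphN1 scaleN1r.
have W0B u v : W0 u -> W0 v -> W0 (u + v).
  by move=> Wu Wv; have := W0D 1 _ _ Wu Wv; rewrite rmorph1 scale1r.
have ii n (u : 'rV[R[i]]_n) : 'i *: ('i *: u) = - u.
  by rewrite scalerA -expr2 sqr_i scaleN1r.
have [re Hre] : {re & forall u, W0 (re u) /\ exists2 w, W0 w & u = re u + 'i *: w}.
  apply: (@choice _ _ (fun u re => W0 re /\ exists2 w, W0 w & u = re + 'i *: w)) => u.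
  by have [w [w' [? ? ?]]] := W0gen u; exists w; split => //; exists w'.
have [im Him] : {im & forall u, W0 (im u) /\ u = re u + 'i *: im u}.
  apply: (@choice _ _ (fun u im => W0 im /\ u = re u + 'i *: im)) => u.
  by have [_ [w ? ?]] := Hre u; exists w.
pose c u := re u - 'i *: im u.
(* Uniqueness of the decomposition frees [c] from the chosen [re] and [im]. *)
have cE w w' : W0 w -> W0 w' -> c (w + 'i *: w') = w - 'i *: w'.
  move=> Ww Ww'; set u := w + 'i *: w'.
  have [Wi uE] := Him u; have [Wr _] := Hre u.
  have E0 : w - re u = 'i *: (im u - w').
    apply/eqP; rewrite subr_eq scalerBr addrAC eq_sym subr_eq eq_sym.
    by rewrite -/u {1}uE addrC.
  have wr : w = re u.
    apply/eqP; rewrite -subr_eq0; apply/eqP.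
    by apply: (W0real _ (im u - w')) => //; apply: W0B => //; exact: W0N.
  rewrite /c -wr; congr (_ - _ *: _).
  move: E0; rewrite -wr subrr => /(congr1 (fun x => 'i *: x)); rewrite ii scaler0.
  by move/eqP; rewrite eq_sym oppr_eq0 subr_eq0 => /eqP.
have Hu u : exists w w', [/\ W0 w, W0 w', u = w + 'i *: w' & c u = w - 'i *: w'].
  by exists (re u), (im u); split => //; [case: (Hre u)|case: (Him u)..].
have cl a u v : c (a *: u + v) = conjc a *: c u + c v.
  have [w [w' [Ww Ww' -> ->]]] := Hu u; have [x [x' [Wx Wx' -> ->]]] := Hu v.
  case: a => a b.
  have -> : (a +i* b) *: (w + 'i *: w') + (x + 'i *: x') =
     (a%:C *: w - b%:C *: w' + x) + 'i *: (a%:C *: w' + b%:C *: w + x').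
    apply/rowP => j; rewrite !mxE; apply/eqP; rewrite eq_complex.
    case: (w 0 j) (w' 0 j) (x 0 j) (x' 0 j) => ? ? [? ?] [? ?] [? ?] /=.
    by apply/andP; split; apply/eqP; ring.
  rewrite cE; last 2 first.
  - by rewrite -scaleNr -rmorphN; apply: (W0B _ _ _ Wx); apply: W0B; exact: W0Z.
  - by apply: (W0B _ _ _ Wx'); apply: W0B; exact: W0Z.
  apply/rowP => j; rewrite !mxE; apply/eqP; rewrite eq_complex.
  case: (w 0 j) (w' 0 j) (x 0 j) (x' 0 j) => ? ? [? ?] [? ?] [? ?] /=.
  by apply/andP; split; apply/eqP; ring.
have cc u : c (c u) = u.
  have [w [w' [Ww Ww' -> ->]]] := Hu u.
  by rewrite -scalerN cE ?scalerN ?opprK//; exact: W0N.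
(* The two sides differ only in the sign of the cross term, the real part of [Q ('i *: w') w], which
   is minus the imaginary part of [Q w' w] and so vanishes. *)
have cQ u : rowRe (Q (c u) (c u)) = rowRe (Q u u).
  have [w [w' [Ww Ww' -> ->]]] := Hu u.
  have cross v : W0 v -> rowRe (Q ('i *: v) w) = 0.
    by move=> Wv; rewrite (hermZl hQ) rowRe_iZ ImQ// oppr0.
  rewrite -scalerN [w + 'i *: - w']addrC [w + _]addrC !rowRe_herm_add//.
  rewrite !cross//; last exact: W0N.
  by rewrite scalerN (hermNl hQ) (hermNr hQ) opprK.
pose s (p : E) : E := (- rowconj p.1, - c p.2).
have slev p : level Q (s p) = level Q p.
  rewrite /level /s /= (hermNl hQ) (hermNr hQ) opprK cQ; congr (_ - _).
  by apply/rowP => j; rewrite !mxE; case: (p.1 0 j) => ? ? /=; rewrite opprK.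
have ss p : s (s p) = p.
  have cN u : c (- u) = - c u.
    have c0 : c 0 = 0.
      by rewrite -[0]addr0 -[X in _ + X](scaler0 _ 'i) cE// scaler0 subr0 addr0.
    by have := cl (-1) u 0; rewrite rmorphN1 !scaleN1r c0 !addr0.
  by rewrite /s /= rowconjN opprK rowconjK cN opprK cc; case: p.
(* For [p.2 = w + 'i *: w'] the displacement is [- w - w], an element of [W0]. *)
have sW p : W ((s p).2 - p.2).
  rewrite /s /=; have [w [w' [Ww Ww' -> ->]]] := Hu p.2.
  rewrite (_ : _ - _ = - w - w).
    by apply: W0W; apply: W0B; exact: W0N.
  by rewrite opprB opprD addrA addrAC [_ - 'i *: w']addrAC subrr sub0r.
have sorb p : s @` act_orbit (heis_group Q W) p = act_orbit (heis_group Q W) p.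
  have sub q : act_orbit (heis_group Q W) p q -> act_orbit (heis_group Q W) p (s q).
    move=> /(heis_orbitP hQ)[lq Wq]; apply/(heis_orbitP hQ); rewrite slev; split => //.
    by have := WB _ _ (sW q) Wq; rewrite addrA subrK.
  apply/seteqP; split=> [_ [q /sub oq <-]//|q /sub oq].
  by exists (s q).
have anti : antiholomorphic_on (siegel_domain Om Q) s.
  move=> p _.
  pose d u := - rowconj (c u).
  have dl a u v : d (a *: u + v) = a *: d u + d v.
    rewrite /d cl rowconjD rowconjZ opprD -scalerN.
    by congr (_ *: _ + _); exact: conjcK.
  (* Both [c] and the standard conjugation are antilinear, so their composite is complex linear and
     hence differentiable. *)
  have sE : @cspaceconj R N M \o s = fun p => (- p.1, d p.2).
    by apply/funext => q; rewrite /s /cspaceconj /= !rowconjN rowconjK.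
  have ls : linear (fun p : E => (- p.1, d p.2) : E).
    move=> a [x1 x2] [y1 y2].
    by rewrite -[LHS]/(- (a *: x1 + y1), d (a *: x2 + y2)) dl opprD -scalerN.
  rewrite sE.
  by have [] := linear_is_diff p ls (pair_linear_continuous ls).
have [k [A [fA HA]]] := real_subspace_basis sW0.
pose S := [set p : E | siegel_domain Om Q p /\ rowRe p.1 = 0 /\
  exists2 w, W0 w & p.2 = 'i *: w].
exists S, (siegel_domain Om Q), s; split; last by move=> p _.
split.
- split => //.
  + exact: (slice_submanifold fA HA W0real (siegel_open oOm hQ)).
  + split; first exact: siegel_open.
    exists ('i *: rowC y0, 0).
    rewrite /siegel_domain /= rowIm_iZ rowRe_rowC (herm0l hQ).
    by rewrite rowRe0 subr0.
  + move=> _ p [x [w [_ ->]]]; rewrite /siegel_domain /=.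
    rewrite -[X in Om X -> _]/(level Q p).
    by rewrite -[X in _ -> Om X]/(level Q (heis Q x w p)) level_heis.
  + move=> p Dp; have [w [w' [Ww Ww' pE _]]] := Hu p.2.
    (* Moving by [- w], which lies in [W], leaves ['i *: w'] as second component; the imaginary part
       of the first is then prescribed by the level. *)
    pose q : E := ('i *: rowC (level Q p + rowRe (Q ('i *: w') ('i *: w'))), 'i *: w').
    have lq : level Q q = level Q p.
      by rewrite {1}/level /q /= rowIm_iZ rowRe_rowC addrK.
    exists q; split.
      split; first by rewrite /siegel_domain /= -[X in Om X]/(level Q q) lq.
      split; first by rewrite /= rowRe_iZ rowIm_rowC oppr0.
      by exists w'.
    apply/(heis_orbitP hQ); split => //.
    by rewrite pE /= opprD addrCA subrr addr0; apply: W0W; exact: W0N.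
- have Ds p : siegel_domain Om Q p -> siegel_domain Om Q (s p).
    rewrite /siegel_domain /= -[X in Om X -> _]/(level Q p).
    by rewrite -[X in _ -> Om X]/(level Q (s p)) slev.
  by exists s; split => //; split.
- move=> p _ [_ [Re0 [w Ww p2]]]; rewrite /s p2 [RHS]surjective_pairing; congr pair.
    apply/rowP => j; move/rowP/(_ j): Re0; rewrite !mxE.
    case: (p.1 0 j) => a b /= ->; apply/eqP.
    by rewrite eq_complex /= oppr0 opprK !eqxx.
  by rewrite p2 -[X in c X]add0r cE// sub0r opprK.
- by move=> p _.
Qed.

End Backward.

Theorem theorem1p2 (R : realType) (N M : nat) (N_gt0 : (0 < N)%N)
    (M_gt0 : (0 < M)%N) (Om : set 'rV[R]_N)
    (Q : 'rV[R[i]]_M -> 'rV[R[i]]_M -> 'rV[R[i]]_N) (W : set 'rV[R[i]]_M) :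
  regular_cone Om -> hermitian_map Q -> cone_positive Om Q -> real_subspace W ->
  strongly_visible_involutive (siegel_domain Om Q) (heis_group Q W) <->
  exists W0 : set 'rV[R[i]]_M,
    [/\ W0 `<=` W, real_form W0
      & forall u v, W0 u -> W0 v -> rowIm (Q u v) = 0].

Proof.
move=> rOm hQ pos sW; split; first exact: strongly_visible_real_form.
by move=> [W0 [W0W rf ImQ]]; exact: (real_form_strongly_visible rOm hQ sW W0W rf ImQ).
Qed.
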